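(* Let $X=(X_t)_{t\ge0}$ be an isotropic unimodal pure jump Lévy process on $\mathbb R^n$ with transition densities $p_t$ and Lévy–Khintchine exponent $\psi$, where $\psi(\xi)=\psi(|\xi|)$ for a continuous strictly increasing function $\psi:[0,\infty)\to[0,\infty)$ for which there are $0<\underline\alpha\le\bar\alpha<2$, $\underline c\in(0,1]$ and $\bar C\in[1,\infty)$ with $$\underline c\,\lambda^{\underline\alpha}\psi(\theta)\le\psi(\lambda\theta)\le\bar C\,\lambda^{\bar\alpha}\psi(\theta)\qquad\text{for all }\lambda\ge1,\ \theta>0.$$ Then the heat kernel $\varphi_t(x,y)=p_t(x-y)$, $t>0$, satisfies: (i) For every $f\in C_c(\mathbb R^n)$ and $x\in\mathbb R^n$, $\lim_{t\to0}\int_{\mathbb R^n}\varphi_t(x,y)f(y)\,dy=f(x)$. (ii) There is $\eta\in(0,1]$ such that for all $R>0$ and $x_1,x_2\in\mathbb R^n$ there is a constant $C=C(R,x_1,x_2)$ with $\varphi_{\eta R}(x_1,y)\le C\varphi_R(x_2,y)$ for all $y\in\mathbb R^n$. Moreover, for every $x\in\mathbb R^n$, $R>0$ and every ball $B_R$ of radius $R$ there is a positive constant $C$ (depending on $x$, $R$ and the ball) with $\varphi_R(x,y)\ge C$ for all $y\in B_R$. (iii) There exist $\gamma\ge1$, functions $\xi_1,\xi_2:\mathbb R^n\times(0,\infty)\to(1,\infty)$ with $\xi_i(\cdot,t)$ bounded on every bounded set for each $t$ ($i=1,2$), and a function $\Gamma:(0,\infty)\to(0,\infty)$ such that for every $R>0$,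 every measurable $f\ge0$ and every $x\in\mathbb R^n$, $$\sup_{0<t<R}\int_{\mathbb R^n}\varphi_t(x,y)f(y)\,dy\le\xi_1(x,R)\,\mathcal M_{\Gamma(R)}f(x)+\xi_2(x,R)\int_{\mathbb R^n}\varphi_{\gamma R}(x,y)f(y)\,dy.$$
   Context: Isotropic unimodal pure jump Lévy process: $X$ is a càdlàg process with $X_0=0$ and stationary independent increments; for $t>0$, $X_t$ has a rotationally invariant density $p_t$ that is radially non-increasing on $\mathbb R^n\setminus\{0\}$; and $$\mathbb E[e^{i\xi\cdot X_t}]=\int_{\mathbb R^n}e^{i\xi\cdot y}p_t(y)\,dy=e^{-t\psi(\xi)},\qquad \psi(\xi)=\int_{\mathbb R^n}(1-\cos(\xi\cdot x))\,\nu(dx),$$ with $\nu$ an isotropic unimodal Lévy measure. $\mathcal M_Rf(x)=\sup_{0<s<R}\frac1{|B(x,s)|}\int_{B(x,s)}|f(y)|\,dy$ is the local Hardy–Littlewood maximal function, with Lebesgue measure and Euclidean balls. Known fact used in the paper: under these hypotheses $p_t(x)$ is comparable, uniformly in $t>0$, $x\ne0$, to $[\psi^{-}(1/t)]^n\wedge\frac{t\,\psi(|x|^{-1})}{|x|^n}$, where $\psi^{-}$ is the inverse of $\psi$ (Bogdan–Grzywny–Ryznar).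
   Formalization: The densities are assumed to satisfy p_t(x) ≤ p_t(0) for all x (as the continuous version does); with p_t(0) arbitrary, e.g. p_t(0)=0, the pointwise bounds in (ii) fail at y=x. *)

(* Defs.v *)
From HB Require Import structures.
From mathcomp Require Import all_boot all_order all_algebra complex.
From mathcomp Require Import all_classical all_reals all_analysis.
From mathcomp Require Import measurable_realfun.

Set Implicit Arguments.
Unset Strict Implicit.
Unset Printing Implicit Defensive.

Import Order.TTheory GRing.Theory Num.Theory numFieldNormedType.Exports.

Local Open Scope classical_set_scope.
Local Open Scope ring_scope.

(** * The Borel sigma-algebra of R^n

    R^n is ['rV[R]_n].  Its topology is the library's, which comes from the sup
    norm; its Borel sigma-algebra is the one generated by the coordinates, as
    for [n.-tuple R] in the library. *)

Section measurable_rV.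
Context {R : realType} (n : nat).

Definition rV_coord : 'I_n -> 'rV[R]_n -> R := fun i x => x ord0 i.

Let rV_set0 : g_sigma_preimage rV_coord set0.
Proof. exact: sigma_algebra0. Qed.

Let rV_setC A : g_sigma_preimage rV_coord A -> g_sigma_preimage rV_coord (~` A).
Proof. exact: sigma_algebraC. Qed.

Let rV_bigcup (F : (set 'rV[R]_n)^nat) :
  (forall i, g_sigma_preimage rV_coord (F i)) ->
  g_sigma_preimage rV_coord (\bigcup_i F i).
Proof. exact: sigma_algebra_bigcup. Qed.

HB.instance Definition _ :=
  @isMeasurable.Build (measure_tuple_display default_measure_display)
    'rV[R]_n (g_sigma_preimage rV_coord) rV_set0 rV_setC rV_bigcup.

End measurable_rV.

Lemma measurable_rV_coord (R : realType) n (i : 'I_n) :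
  measurable_fun [set: 'rV[R]_n] (fun x => x ord0 i).
Proof.
move=> _ Y mY; rewrite setTI; apply: sub_sigma_algebra => /=.
rewrite -bigcup_seq/=; exists i => /=; first by rewrite mem_index_enum.
by exists Y => //; rewrite setTI.
Qed.

Lemma measurable_fun_rVP d (T : measurableType d) (R : realType) n
    (f : T -> 'rV[R]_n) :
  (forall i, measurable_fun [set: T] (fun x => f x ord0 i)) ->
  measurable_fun [set: T] f.
Proof.
move=> mf _; have : g_sigma_preimage (fun i x => f x ord0 i) `<=`
    (@measurable d T).
  apply: smallest_sub; first exact: sigma_algebra_measurable.
  case: n f mf => [|n] f mf; first by rewrite big_ord0.
  rewrite -bigcup_mkord_ord; apply: bigcup_sub => i Ii.
  by move=> A [B mB <-]; exact: mf.
rewrite (_ : (fun _ _ => _) = fun i => @rV_coord R n i \o f)//.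
rewrite g_sigma_preimage_comp => h A mA; apply: h.
by exists A.
Qed.

(** * Lebesgue measure on R^n

    [lebesgue_rV n.+1] is the image of the product of the Lebesgue measure on R
    with [lebesgue_rV n] under (a, x) |-> (a, x_1, ..., x_n). *)

Section lebesgue_rV.
Variable R : realType.

Definition cons_rV n (p : measurableTypeR R * 'rV[R]_n) : 'rV[R]_n.+1 :=
  row_mx (const_mx p.1 : 'rV[R]_1) p.2.

Definition uncons_rV n (x : 'rV[R]_n.+1) : measurableTypeR R * 'rV[R]_n :=
  (x ord0 ord0, \row_i x ord0 (lift ord0 i)).

Lemma cons_rV0 n p : @cons_rV n p ord0 ord0 = p.1.
Proof.
have /= := row_mxEl (const_mx p.1 : 'rV[R]_1) p.2 ord0 ord0.
rewrite [RHS]mxE; apply: etrans.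
by congr (cons_rV p ord0 _); exact/val_inj.
Qed.

Lemma cons_rVS n p i : @cons_rV n p ord0 (lift ord0 i) = p.2 ord0 i.
Proof.
apply: etrans (row_mxEr (const_mx p.1 : 'rV[R]_1) p.2 ord0 i).
by congr (cons_rV p ord0 _); exact/val_inj.
Qed.

Lemma cons_rVK n : cancel (@cons_rV n) (@uncons_rV n).
Proof.
case=> a x; rewrite /uncons_rV cons_rV0; congr pair.
by apply/rowP => i; rewrite mxE cons_rVS.
Qed.

Lemma measurable_cons_rV n : measurable_fun [set: _] (@cons_rV n).
Proof.
apply: measurable_fun_rVP => i; have [j ->|->] := unliftP ord0 i.
  under eq_fun do rewrite cons_rVS.
  apply: (measurableT_comp (@measurable_rV_coord R n j)).
  exact: measurable_snd.
under eq_fun do rewrite cons_rV0.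
exact: measurable_fst.
Qed.

Lemma measurable_uncons_rV n : measurable_fun [set: _] (@uncons_rV n).
Proof.
apply/measurable_fun_pair; first exact: measurable_rV_coord.
apply: measurable_fun_rVP => i; under eq_fun do rewrite mxE.
exact: measurable_rV_coord.
Qed.

Section cons_measure.
Variables (n : nat) (mu : {sigma_finite_measure set 'rV[R]_n -> \bar R}).

Definition cons_measure : set 'rV[R]_n.+1 -> \bar R :=
  pushforward (lebesgue_measure \x mu)%E (@cons_rV n).

Let cons_measure0 : cons_measure set0 = 0%E.
Proof. by rewrite /cons_measure /pushforward preimage_set0 measure0. Qed.

Let cons_measure_ge0 A : (0 <= cons_measure A)%E.
Proof. by rewrite /cons_measure /pushforward measure_ge0. Qed.

Let cons_measure_sigma_additive : semi_sigma_additive cons_measure.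
Proof.
move=> F mF tF mUF; rewrite /cons_measure /pushforward preimage_bigcup.
apply: measure_semi_sigma_additive.
- by move=> k; rewrite -[X in measurable X]setTI; exact: measurable_cons_rV.
- apply/trivIsetP => /= i j _ _ ij; rewrite -preimage_setI.
  by move/trivIsetP : tF => /(_ _ _ _ _ ij) ->//; rewrite preimage_set0.
- rewrite -preimage_bigcup -[X in measurable X]setTI.
  exact: measurable_cons_rV.
Qed.

HB.instance Definition _ := isMeasure.Build _ _ _ cons_measure
  cons_measure0 cons_measure_ge0 cons_measure_sigma_additive.

Let cons_measure_sigma_finite : sigma_finite [set: _] cons_measure.
Proof.
have /sigma_finiteP[F [TF ndF Foo]] := sigma_finiteT (@lebesgue_measure R).
have /sigma_finiteP[G [TG ndG Goo]] := sigma_finiteT mu.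
exists (fun k => @uncons_rV n @^-1` (F k `*` G k)) => [|k].
  rewrite -preimage_bigcup (_ : \bigcup_i _ = setT) ?preimage_setT//.
  rewrite -setXTT TF TG predeqE => -[x y]; split.
    by move=> [k _ []/= ? ?]; split; exists k.
  move=> [/= [k _ Fkx] [l _ Gly]]; exists (maxn k l) => //; split.
    by move: x Fkx; exact/subsetPset/ndF/leq_maxl.
  by move: y Gly; exact/subsetPset/ndG/leq_maxr.
have [mF ?] := Foo k; have [mG ?] := Goo k; split.
  rewrite -[X in measurable X]setTI; apply: measurable_uncons_rV => //.
  exact: measurableX.
rewrite /cons_measure /pushforward (_ : _ @^-1` _ = F k `*` G k); last first.
  by apply/seteqP; split => p; rewrite /preimage /mkset cons_rVK.
by rewrite product_measure1E// lte_mul_pinfty// ge0_fin_numE.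
Qed.

HB.instance Definition _ := Measure_isSigmaFinite.Build _ _ _ cons_measure
  cons_measure_sigma_finite.

End cons_measure.

Fixpoint lebesgue_rV n : {sigma_finite_measure set 'rV[R]_n -> \bar R} :=
  if n is m.+1 then cons_measure (lebesgue_rV m) else dirac (0 : 'rV[R]_0).

End lebesgue_rV.

Lemma lebesgue_rV_box (R : realType) n (A : 'I_n -> set R) :
  (forall i, measurable (A i)) ->
  lebesgue_rV R n [set x | forall i, A i (x ord0 i)] =
  (\prod_(i < n) lebesgue_measure (A i))%E.
Proof.
elim: n A => [|n IH] A mA.
  rewrite big_ord0 /= diracE mem_set//=; first by case.
rewrite big_ord_recl -(IH (fun i => A (lift ord0 i)))//.
transitivity ((lebesgue_measure \x lebesgue_rV R n)%E
    (A ord0 `*` [set x : 'rV[R]_n | forall i, A (lift ord0 i) (x ord0 i)])).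
  congr (product_measure1 _ _ _).
  apply/seteqP; split => [p /= Ap|p /= [A0 AS] i].
    by split=> [|i]; [rewrite -(cons_rV0 p)|rewrite -(cons_rVS p)]; exact: Ap.
  have [j ->|->] := unliftP ord0 i; last by rewrite cons_rV0.
  by rewrite cons_rVS; exact: AS.
rewrite product_measure1E//; first exact: mA.
rewrite (_ : mkset _ =
    \bigcap_(i in [set: 'I_n])
      ((fun x : 'rV[R]_n => x ord0 i) @^-1` A (lift ord0 i))).
  apply: fin_bigcap_measurable => // i _; rewrite -[X in measurable X]setTI.
  exact: measurable_rV_coord.
by apply/seteqP; split => [x Ax i _|x Ax i]; [exact: Ax|exact: (Ax i Logic.I)].
Qed.

(** * Euclidean geometry *)

Section euclidean.
Context {R : realType} {n : nat}.
Implicit Types (x y : 'rV[R]_n) (f : 'rV[R]_n -> R).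

Definition dotv x y : R := \sum_i x ord0 i * y ord0 i.

Definition enorm x : R := Num.sqrt (dotv x x).

Definition eball x (r : R) : set 'rV[R]_n := [set y | enorm (y - x) < r].

(** Invariance under the full orthogonal group: in dimension 1 the special
    orthogonal group is trivial, and isotropy then means symmetry. *)
Definition rotation_invariant f :=
  forall (Q : 'M[R]_n) x, Q *m Q^T = 1%:M -> f (x *m Q) = f x.

(** Along rays, on R^n \ {0}: the value at the origin is not constrained. *)
Definition radially_nonincreasing f :=
  forall x (a : R), x != 0 -> 1 <= a -> f (a *: x) <= f x.

Definition compactly_supported f := compact (closure [set x | f x != 0]).

(** The local Hardy-Littlewood maximal function, centered, over the radii in
    ]0, r[; compare [iavg] and [HL_maximal], which are on the line. *)
Definition local_maximal (r : R) (f : 'rV[R]_n -> \bar R) x : \bar R :=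
  ereal_sup [set ((lebesgue_rV R n (eball x s))^-1 *
                  \int[lebesgue_rV R n]_(y in eball x s) `|f y|)%E
            | s in `]0, r[].

End euclidean.

(** * Isotropic unimodal pure jump Levy processes *)

Section isotropic_unimodal.
Context {R : realType} {n : nat}.
Implicit Types (f : 'rV[R]_n -> R) (nu : {measure set 'rV[R]_n -> \bar R}).

Record isotropic_unimodal_density f : Prop := {
  iud_measurable : measurable_fun [set: 'rV[R]_n] f ;
  iud_ge0 : forall x, 0 <= f x ;
  iud_rotation : rotation_invariant f ;
  iud_nonincreasing : radially_nonincreasing f }.

Record levy_measure nu : Prop := {
  lm_origin : nu [set 0] = 0%E ;
  lm_integrable : (\int[nu]_x (Num.min 1 (enorm x ^+ 2))%:E < +oo)%E }.

Record isotropic_unimodal_levy_measure nu : Prop := {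
  iulm_levy : levy_measure nu ;
  iulm_density : exists2 f, isotropic_unimodal_density f &
    forall A : set 'rV[R]_n, measurable A -> ~ A 0 ->
      nu A = (\int[lebesgue_rV R n]_(x in A) (f x)%:E)%E }.

End isotropic_unimodal.

Section levy.
Context {R : realType} {n : nat} {d : measure_display} {Omega : measurableType d}.
Variables (P : probability Omega R) (X : R -> {RV P >-> 'rV[R]_n}).

Definition cadlag (x : R -> 'rV[R]_n) :=
  (forall t : R, 0 <= t -> x s @[s --> t^'+] --> x t) /\
  (forall t : R, 0 < t -> cvg (x s @[s --> t^'-])).

Definition stationary_increments :=
  forall (s t : R) A, 0 <= s -> s <= t -> measurable A ->
    P [set w | A (X t w - X s w)] = P [set w | A (X (t - s) w)].

Definition independent_increments :=
  forall (k : nat) (t : nat -> R) (A : nat -> set 'rV[R]_n),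
    0 <= t 0%N -> (forall i, t i <= t i.+1) -> (forall i, measurable (A i)) ->
    P (\bigcap_(i < k) [set w | A i (X (t i.+1) w - X (t i) w)]) =
    (\prod_(i < k) P [set w | A i (X (t i.+1) w - X (t i) w)%R])%E.

(** The time index ranges over [0, +oo[; [X t] is irrelevant for t < 0. *)
Record levy_process : Prop := {
  lp_start : {ae P, forall w, X 0 w = 0} ;
  lp_cadlag : {ae P, forall w, cadlag (fun t => X t w)} ;
  lp_stationary : stationary_increments ;
  lp_independent : independent_increments }.

Definition charfun (Y : {RV P >-> 'rV[R]_n}) (xi : 'rV[R]_n) : R[i] :=
  ((\int[P]_w cos (dotv xi (Y w))) +i* (\int[P]_w sin (dotv xi (Y w))))%C.

(** A density is only defined almost everywhere, and radial monotonicity on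
    R^n \ {0} leaves p_t(0) arbitrary.  [iul_origin] selects a version whose
    radial monotonicity extends to the origin, such as the continuous one. *)
Record isotropic_unimodal_levy_process
    (p : R -> 'rV[R]_n -> R) (Psi : 'rV[R]_n -> R) : Prop := {
  iul_levy : levy_process ;
  iul_unimodal : forall t : R, 0 < t -> isotropic_unimodal_density (p t) ;
  iul_origin : forall (t : R) x, 0 < t -> p t x <= p t 0 ;
  iul_density : forall (t : R) A, 0 < t -> measurable A ->
    distribution P (X t) A = (\int[lebesgue_rV R n]_(x in A) (p t x)%:E)%E ;
  iul_charfun : forall (t : R) xi, 0 < t ->
    charfun (X t) xi = (expR (- (t * Psi xi)))%:C%C ;
  iul_exponent : exists2 nu : {measure set 'rV[R]_n -> \bar R},
    isotropic_unimodal_levy_measure nu &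
    forall xi, (Psi xi)%:E = (\int[nu]_x (1 - cos (dotv xi x))%:E)%E }.

End levy.

(** Weak lower and upper scaling, at all scales. *)
Definition weak_scaling {R : realType} (psi : R -> R) (al au cl cu : R) :=
  forall lambda theta : R, 1 <= lambda -> 0 < theta ->
    cl * lambda `^ al * psi theta <= psi (lambda * theta) /\
    psi (lambda * theta) <= cu * lambda `^ au * psi theta.

Definition heat_kernel {R : realType} {n : nat} (p : R -> 'rV[R]_n -> R)
  (t : R) (x y : 'rV[R]_n) : R := p t (x - y).

(* Main.v *)
Require Import Defs.
From mathcomp Require Import all_boot all_order all_algebra complex.
From mathcomp Require Import all_classical all_reals all_analysis.
From mathcomp Require Import measurable_realfun.
From mathcomp Require Import ring lra.

Import Order.TTheory GRing.Theory Num.Theory numFieldNormedType.Exports.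

Set Implicit Arguments.
Unset Strict Implicit.
Unset Printing Implicit Defensive.

Local Open Scope classical_set_scope.
Local Open Scope ring_scope.

(** Everything follows from two-sided bounds on [p_t], obtained by testing
    [E (1 - cos (xi . X_t)) = 1 - exp (- t psi |xi|)] against unimodality.
    Upper bound: on the box [a/2, a[^n inside the ball of radius |z| one has
    [p_t >= p_t z] and, for xi = e_1 / a, [1 - cos >= 1 - cos (1/2)], whence
    [p_t z <= C t psi (sqrt n / |z|) / |z|^n] for all t.  Summing it over dyadic
    shells gives [P (|X_t| >= r) <= C t psi (sqrt n / r)].
    Lower bound, once [t psi (sqrt n / r) <= 1]: at frequency
    [s = delta sqrt n / r] split the expectation at |x| = r and |x| = 2^N r.
    The inner part is at most [C delta^2 t psi (sqrt n / r)], which for small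
    delta is negligible against [t psi s >= c delta^au t psi (sqrt n / r)] since
    au < 2; the outer part is negligible for large N; so the middle part, at most
    [C_N r^n p_t z] for |z| <= r, is not.
    With the bounds at hand, (ii) holds with eta = 1 and (iii) with gamma = 1:
    far from x, p_t is dominated by p_R, and near x the dyadic shells of the
    radially nonincreasing p_t are controlled by the maximal function. *)

(** * Euclidean norm against the sup norm, and radial comparison of points *)

Section euclidean_norm.
Context {R : realType} {n : nat}.
Implicit Types (x y : 'rV[R]_n).

Lemma dotvE x y : dotv x y = (x *m y^T) ord0 ord0.
Proof. by rewrite mxE; apply: eq_bigr => i _; rewrite mxE. Qed.

Lemma dotvv_ge0 x : 0 <= dotv x x.
Proof. by apply: sumr_ge0 => i _; rewrite -expr2 sqr_ge0. Qed.

Lemma enorm_ge0 x : 0 <= enorm x.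
Proof. exact: sqrtr_ge0. Qed.

Lemma sqr_enorm x : enorm x ^+ 2 = dotv x x.
Proof. by rewrite sqr_sqrtr// dotvv_ge0. Qed.

Lemma enormZ (a : R) x : enorm (a *: x) = `|a| * enorm x.
Proof.
rewrite /enorm -sqrtr_sqr -sqrtrM ?sqr_ge0//; congr Num.sqrt.
rewrite /dotv mulr_sumr; apply: eq_bigr => i _; rewrite !mxE; ring.
Qed.

Lemma norm_coord_le x i : `|x ord0 i| <= `|x|.
Proof.
rewrite /Num.norm/= mx_normrE.
exact: (le_bigmax _ (fun ij => `|x ij.1 ij.2|) (ord0, i)).
Qed.

Lemma norm_rV_lt x (r : R) : 0 < r ->
  (`|x| < r) <-> (forall i, `|x ord0 i| < r).
Proof.
move=> r0; split => [xr i|H]; first exact: le_lt_trans (norm_coord_le x i) xr.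
rewrite /Num.norm/= mx_normrE; apply/bigmax_ltP; split => // -[i j] _ /=.
by rewrite (ord1 i).
Qed.

Lemma norm_rV_le x (r : R) : 0 <= r ->
  (forall i, `|x ord0 i| <= r) -> `|x| <= r.
Proof.
move=> r0 H; rewrite /Num.norm/= mx_normrE.
by apply/bigmax_leP; split => // -[i j] _ /=; rewrite (ord1 i).
Qed.

Lemma norm_le_enorm x : `|x| <= enorm x.
Proof.
apply: norm_rV_le (enorm_ge0 _) _ => i.
rewrite -sqrtr_sqr ler_wsqrtr// /dotv (bigD1 i)//= expr2 lerDl.
by apply: sumr_ge0 => j _; rewrite -expr2 sqr_ge0.
Qed.

Lemma enorm_le_norm x : enorm x <= Num.sqrt n%:R * `|x|.
Proof.
rewrite -[X in _ * X]ger0_norm// -sqrtr_sqr -sqrtrM ?ler0n// ler_wsqrtr//.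
rewrite /dotv mulrC -[n in n%:R]card_ord -sum1_card natr_sum mulr_sumr.
apply: ler_sum => i _; rewrite mulr1 -expr2 -real_normK ?num_real//.
by rewrite ler_sqr ?nnegrE// norm_coord_le.
Qed.

Lemma measurable_enorm : measurable_fun [set: 'rV[R]_n] enorm.
Proof.
apply: (measurableT_comp (continuous_measurable_fun (@sqrt_continuous R))).
apply: measurable_sum => i.
by apply: measurable_funM; exact: measurable_rV_coord.
Qed.

Lemma exists_enorm (r : R) : (0 < n)%N -> 0 <= r -> exists x, enorm x = r.
Proof.
move=> n0 r0; pose i0 := Ordinal n0.
exists (r *: \row_j (j == i0)%:R); rewrite enormZ ger0_norm//.
rewrite (_ : enorm _ = 1) ?mulr1// /enorm /dotv (bigD1 i0)//= big1.
  by rewrite mxE eqxx mulr1 addr0 sqrtr1.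
by move=> i /negPf ii0; rewrite mxE ii0 mul0r.
Qed.

(* A Householder reflection does it. *)
Lemma orthogonal_map_enorm x y : enorm x = enorm y ->
  exists2 Q : 'M[R]_n, Q *m Q^T = 1%:M & x *m Q = y.
Proof.
move=> xy; have [->|xney] := eqVneq x y.
  by exists 1%:M; rewrite ?trmx1 mulmx1.
pose u := x - y; pose c := (u *m u^T) ord0 ord0.
have uu : u *m u^T = c%:M by rewrite [LHS]mx11_scalar.
have c0 : c != 0.
  rewrite /c -dotvE -sqr_enorm sqrf_eq0 gt_eqF//.
  by rewrite (lt_le_trans _ (norm_le_enorm _))// normr_gt0 subr_eq0.
have xu : x *m u^T = (c / 2)%:M.
  rewrite [LHS]mx11_scalar; congr _%:M; rewrite /c -!dotvE.
  have : dotv u u + (dotv x x - dotv y y) = 2 * dotv x u.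
    rewrite /dotv mulr_sumr -sumrB -big_split/=; apply: eq_bigr => i _.
    by rewrite !mxE; ring.
  by rewrite -!sqr_enorm xy subrr addr0 => ->; rewrite mulrC mulKf.
exists (1%:M - (2 / c) *: (u^T *m u)).
  have sym k (v : 'rV[R]_n) :
      (1%:M - k *: (v^T *m v))^T = 1%:M - k *: (v^T *m v).
    by rewrite linearB/= linearZ/= trmx1 trmx_mul trmxK.
  rewrite sym; set K := _ *: _; have KK : K *m K = K + K.
    rewrite /K -scalemxAl -scalemxAr scalerA -mulmxA (mulmxA u) uu.
    rewrite mul_scalar_mx -scalemxAr scalerA -scalerDl; congr (_ *: _).
    by field.
  rewrite mulmxBl !mulmxBr !mul1mx mulmx1 KK opprB.
  by rewrite addrK subrK.
rewrite mulmxBr mulmx1 -scalemxAr mulmxA xu mul_scalar_mx scalerA.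
rewrite (_ : 2 / c * (c / 2) = 1); last by field.
by rewrite scale1r /u opprB addrC subrK.
Qed.

(** An orthogonal map sends the multiple of [x] that has the norm of [y] to [y], so monotonicity
    along one ray compares different rays. The case [x = 0] rests on the bound by [q 0]. *)
Lemma unimodal_le (q : 'rV[R]_n -> R) x y :
  isotropic_unimodal_density q -> (forall z, q z <= q 0) ->
  enorm x <= enorm y -> q y <= q x.
Proof.
move=> [_ _ rot dec] q0 xy; have [->|x0] := eqVneq x 0; first exact: q0.
have ex0 : 0 < enorm x.
  by rewrite (lt_le_trans _ (norm_le_enorm _))// normr_gt0.
have [|Q QQ <-] := @orthogonal_map_enorm ((enorm y / enorm x) *: x) y.
  by rewrite enormZ ger0_norm ?divr_ge0 ?enorm_ge0// divfK// gt_eqF.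
by rewrite rot// dec// ler_pdivlMr// mul1r.
Qed.

End euclidean_norm.

(** * Cubes, boxes and balls, and their volumes *)

Section cubes.
Context {R : realType} {n : nat}.
Implicit Types (x y : 'rV[R]_n) (r a : R).

(** Open sup-norm balls of half-side [r]: as products of intervals they have exact volumes, and they
    nest with Euclidean balls up to a factor sqrt n in the radius. *)
Definition cube x r : set 'rV[R]_n := [set y | `|y - x| < r].

(** For [a > 0] every coordinate is within a factor 2 of [a], so one frequency along one axis tests
    the whole box; if [n > 0], the box also lies in [cube 0 a] and avoids [cube 0 (a / 2)]. *)
Definition corner a : set 'rV[R]_n := [set x | forall i, a / 2 <= x ord0 i < a].

Lemma boxE (A : 'I_n -> set R) : [set x : 'rV[R]_n | forall i, A i (x ord0 i)] =
  \bigcap_(i in [set: 'I_n]) ((fun x : 'rV[R]_n => x ord0 i) @^-1` A i).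
Proof.
by apply/seteqP; split => [x Ax i _|x Ax i]; [exact: Ax|exact: (Ax i Logic.I)].
Qed.

Lemma measurable_box (A : 'I_n -> set R) : (forall i, measurable (A i)) ->
  measurable [set x : 'rV[R]_n | forall i, A i (x ord0 i)].
Proof.
move=> mA; rewrite boxE; apply: fin_bigcap_measurable => // i _.
by rewrite -[X in measurable X]setTI; exact: measurable_rV_coord.
Qed.

Lemma cubeE x r : 0 < r ->
  cube x r = [set y | forall i, ball (x ord0 i) r (y ord0 i)].
Proof.
move=> r0; apply/seteqP; split => y; rewrite /cube /= norm_rV_lt// => H i.
  by have := H i; rewrite !mxE distrC.
by have := H i; rewrite !mxE distrC.
Qed.

Lemma measurable_cube x r : 0 < r -> measurable (cube x r).
Proof.
move=> r0; rewrite cubeE//; apply: (@measurable_box (fun i => ball (x ord0 i) r)).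
by move=> i; exact: measurable_ball.
Qed.

Lemma lebesgue_cube x r : 0 < r ->
  lebesgue_rV R n (cube x r) = ((2 * r) ^+ n)%:E.
Proof.
move=> r0; rewrite cubeE// (@lebesgue_rV_box _ _ (fun i => ball (x ord0 i) r)) => [|i].
  2: exact: measurable_ball.
rewrite (eq_bigr (fun=> (2 * r)%:E)) => [|i _].
  by rewrite prodEFin prodr_const card_ord.
by rewrite lebesgue_measure_ball ?ltW// mulr_natl.
Qed.

Lemma cornerE a : corner a = [set x | forall i, `[a / 2, a[%classic (x ord0 i)].
Proof. by apply/seteqP; split => x H i; have := H i; rewrite /= in_itv. Qed.

Lemma measurable_corner a : measurable (corner a).
Proof.
by rewrite cornerE; exact: (@measurable_box (fun=> `[a / 2, a[%classic)).
Qed.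

Lemma lebesgue_corner a : 0 < a ->
  lebesgue_rV R n (corner a) = ((a / 2) ^+ n)%:E.
Proof.
move=> a0; rewrite cornerE (@lebesgue_rV_box _ _ (fun=> `[a / 2, a[%classic))//.
rewrite (eq_bigr (fun=> (a / 2)%:E)) => [|i _].
  by rewrite prodEFin prodr_const card_ord.
rewrite lebesgue_measure_itv/= lte_fin ifT; last by lra.
by rewrite -EFinB; congr _%:E; field.
Qed.

Lemma measurable_eball x r : measurable (eball x r).
Proof.
rewrite /eball -[X in measurable X]setTI (_ : [set y | _] =
    (fun y => enorm (y - x)) @^-1` `]-oo, r[); last first.
  by apply/seteqP; split => y /=; rewrite in_itv.
apply: (measurableT_comp (@measurable_enorm R n)) => //.
apply: measurable_fun_rVP => i; under eq_fun do rewrite !mxE.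
by apply: measurable_funD => //; exact: measurable_rV_coord.
Qed.

Lemma eball_sub_cube x r : eball x r `<=` cube x r.
Proof. by move=> y; rewrite /eball /cube /=; exact/le_lt_trans/norm_le_enorm. Qed.

Lemma cube_sub_eball x r : (0 < n)%N ->
  cube x r `<=` eball x (Num.sqrt n%:R * r).
Proof.
move=> n0 y; rewrite /eball /cube /= => H.
apply: le_lt_trans (enorm_le_norm _) _.
by rewrite ltr_pM2l// sqrtr_gt0 ltr0n.
Qed.

Lemma lebesgue_eball_le x r : 0 < r ->
  (lebesgue_rV R n (eball x r) <= ((2 * r) ^+ n)%:E)%E.
Proof.
move=> r0; rewrite -(lebesgue_cube x)//; apply: le_measure; rewrite ?inE.
- exact: measurable_eball.
- exact: measurable_cube.
- exact: eball_sub_cube.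
Qed.

(** The ball contains the cube of half-side r / sqrt n. With the upper bound above, this makes the
    normalization in [local_maximal] finite. *)
Lemma lebesgue_eball_gt0 x r : (0 < n)%N -> 0 < r ->
  (0 < lebesgue_rV R n (eball x r))%E.
Proof.
move=> n0 r0; have s0 : 0 < Num.sqrt n%:R :> R by rewrite sqrtr_gt0 ltr0n.
have q0 : 0 < r / Num.sqrt n%:R by rewrite divr_gt0.
apply: (@lt_le_trans _ _ (lebesgue_rV R n (cube x (r / Num.sqrt n%:R)))).
  by rewrite lebesgue_cube// lte_fin exprn_gt0// mulr_gt0.
apply: le_measure; rewrite ?inE.
- exact: measurable_cube.
- exact: measurable_eball.
- have := @cube_sub_eball x (r / Num.sqrt n%:R) n0.
  by rewrite [Num.sqrt _ * _]mulrC divfK// gt_eqF.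
Qed.

End cubes.

(** * Measurability of reflections and of continuous functions *)

Section measurability.
Context {R : realType} {n : nat}.

Lemma measurable_rV_subl (x : 'rV[R]_n) :
  measurable_fun [set: 'rV[R]_n] (fun y => x - y).
Proof.
apply: measurable_fun_rVP => i; under eq_fun do rewrite !mxE.
by apply: measurable_funB => //; exact: measurable_rV_coord.
Qed.

(* A continuous function is the pointwise limit of its compositions with the
   roundings to 2^-k Z^n, which take countably many values. *)
Lemma continuous_measurable_rV (f : 'rV[R]_n -> R) : continuous f ->
  measurable_fun [set: 'rV[R]_n] f.
Proof.
move=> cf.
pose rnd (k : nat) (x : 'rV[R]_n) : 'rV[int]_n :=
  \row_i Num.floor (2 ^+ k * x ord0 i).
pose dec (k : nat) (m : 'rV[int]_n) : 'rV[R]_n := \row_i ((m ord0 i)%:~R / 2 ^+ k).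
have rndE k (m : 'rV[int]_n) : rnd k @^-1` [set m] = [set x | forall i,
    `[(m ord0 i)%:~R / 2 ^+ k, ((m ord0 i + 1)%:~R) / 2 ^+ k[%classic (x ord0 i)].
  have floorE (a : R) (j : int) :
      (Num.floor (2 ^+ k * a) == j) = (j%:~R / 2 ^+ k <= a < (j + 1)%:~R / 2 ^+ k).
    by rewrite floor_eq ler_pdivrMr ?ltr_pdivlMr ?exprn_gt0// (mulrC a).
  apply/seteqP; split => x /=.
    by move=> <- i; rewrite mxE in_itv/= -floorE.
  by move=> H; apply/rowP => i; rewrite mxE; apply/eqP; rewrite floorE; exact: H.
apply: (measurable_fun_cvg (h := fun k x => f (dec k (rnd k x)))) => //.
  move=> k _ Y _; rewrite setTI.
  rewrite (_ : _ @^-1` _ =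
      \bigcup_(m in [set m | Y (f (dec k m))]) (rnd k @^-1` [set m])); last first.
    apply/seteqP; split => [x/= Yx|x [m /= Ym xm]]; first by exists (rnd k x).
    by rewrite /preimage/= in xm *; rewrite xm.
  rewrite bigcup_mkcond; apply: countable_bigcupT_measurable => [|m].
    exact: countableP.
  case: ifPn => // _; rewrite rndE; exact: (@measurable_box _ _ (fun i =>
    `[(m ord0 i)%:~R / 2 ^+ k, (m ord0 i + 1)%:~R / 2 ^+ k[%classic)).
move=> x _; apply: (@cvg_comp _ _ _ (fun k => dec k (rnd k x)) f _ _ _ _ (cf x)).
apply/cvgrPdist_lt => e e0; near=> k; apply/norm_rV_lt => // i; rewrite !mxE.
have k0 : 0 < 2 ^+ k :> R by rewrite exprn_gt0.
have ke : (2 ^+ k)^-1 < e.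
  by rewrite -div1r; near: k; exact: (near_infty_natSinv_expn_lt (PosNum e0)).
apply: le_lt_trans ke; set a := x ord0 i.
have := floor_itv (2 ^+ k * a); set j := Num.floor _ => /andP[ja aj].
have -> : a - j%:~R / 2 ^+ k = (2 ^+ k * a - j%:~R) / 2 ^+ k.
  by field; rewrite gt_eqF.
rewrite normrM normfV (gtr0_norm k0) ler_pdivrMr// mulVf ?gt_eqF//.
rewrite ger0_norm ?subr_ge0// lerBlDr; apply: ltW.
by rewrite addrC -[1]/(1%:~R) -intrD.
Unshelve. all: by end_near. Qed.

End measurability.

(** * Invariance of Lebesgue measure under [y |-> x - y] *)

Section reflection.
Context {R : realType}.

(** By uniqueness of Lebesgue measure it suffices to test half-open intervals, which the reflection
    turns into intervals of the same length closed at the other end. *)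
Lemma lebesgue_measure_subl (a : R) (A : set (measurableTypeR R)) :
  measurable A ->
  lebesgue_measure ((fun y => a - y : measurableTypeR R) @^-1` A) =
  lebesgue_measure A.
Proof.
move=> mA; pose T := fun y : measurableTypeR R => a - y : measurableTypeR R.
have mT : measurable_fun setT T by exact: measurable_funB.
apply/esym.
apply: (lebesgue_measure_unique (mu := pushforward lebesgue_measure T)) => //.
move=> _ [[c e]] _ <-.
have E (y : R) : (a - e <= y < a - c) = (c < a - y <= e).
  by apply/idP/idP => /andP[? ?]; apply/andP; split; lra.
transitivity (lebesgue_measure (`[a - e, a - c[%classic : set R)).
  rewrite !lebesgue_measure_itv/= !lte_fin ltrD2l ltrN2.
  by case: ifPn => // _; rewrite -!EFinB; congr _%:E; ring.
congr (lebesgue_measure _).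
by apply/seteqP; split => y; rewrite /T /= !in_itv/= E.
Qed.

(** By induction on the dimension: the reflection acts separately on the first coordinate and on the
    others, and a product measure is determined by its values on rectangles. *)
Lemma lebesgue_rV_subl n (x : 'rV[R]_n) A : measurable A ->
  lebesgue_rV R n ((fun y => x - y) @^-1` A) = lebesgue_rV R n A.
Proof.
elim: n x A => [x A _|n IH x A mA].
  rewrite (_ : _ @^-1` A = A)//; apply/seteqP.
  by split => y /=; rewrite (_ : x - y = y)//; apply/rowP => -[].
pose T (q : measurableTypeR R * 'rV[R]_n) : measurableTypeR R * 'rV[R]_n :=
  (x ord0 ord0 - q.1, (\row_i x ord0 (lift ord0 i)) - q.2).
have mT : measurable_fun setT T.
  apply/measurable_fun_pair; first exact: measurable_funB.
  exact: (measurableT_comp (@measurable_rV_subl R n _) measurable_snd).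
have mcA : measurable (@cons_rV R n @^-1` A).
  by rewrite -[X in measurable X]setTI; exact: measurable_cons_rV.
transitivity (pushforward (lebesgue_measure \x lebesgue_rV R n)%E T
    (@cons_rV R n @^-1` A)).
  rewrite /= /cons_measure /pushforward; congr (_ _).
  have xE q : x - cons_rV q = cons_rV (T q).
    apply/rowP => i; rewrite [LHS]mxE [X in _ + X]mxE.
    have [j ->|->] := unliftP ord0 i; last by rewrite !cons_rV0.
    by rewrite !cons_rVS !mxE.
  by apply/seteqP; split => q; rewrite /preimage /= xE.
transitivity ((lebesgue_measure \x lebesgue_rV R n)%E (@cons_rV R n @^-1` A)) => //.
apply/esym; apply: (product_measure_unique
  (m' := pushforward (lebesgue_measure \x lebesgue_rV R n)%E T)) => //.
move=> B C mB mC.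
rewrite /= /pushforward (_ : T @^-1` _ = 
  ((fun y => x ord0 ord0 - y : measurableTypeR R) @^-1` B) `*`
  ((fun y => (\row_i x ord0 (lift ord0 i)) - y) @^-1` C)) //.
rewrite product_measure1E.
- by congr (_ * _)%E; [exact: lebesgue_measure_subl|exact: IH].
- rewrite -[X in measurable X]setTI.
  by apply: (measurable_funB (measurable_cst _) (@measurable_id _ _ _)).
- by rewrite -[X in measurable X]setTI; exact: measurable_rV_subl.
Qed.

End reflection.

(** * Elementary bounds on [1 - cos y] and [1 - expR (- y)] *)

Section trigonometry.
Context {R : realType}.
Implicit Types y : R.

Lemma one_sub_cos_ge0 y : 0 <= 1 - cos y.
Proof. by rewrite subr_ge0 cos_le1. Qed.

Lemma one_sub_cos_le2 y : 1 - cos y <= 2.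
Proof. by have := cos_geN1 y; lra. Qed.

Lemma norm_sin_le y : `|sin y| <= `|y|.
Proof.
wlog y0 : y / 0 <= y.
  move=> H; have [/H//|/ltW y0] := leP 0 y.
  by rewrite -normrN -sinN -[leRHS]normrN H// oppr_ge0.
have [c _] := @MVT_segment R sin cos 0 y y0 (fun _ _ => is_derive_sin _)
  (continuous_subspaceT (@continuous_sin R)).
by rewrite sin0 !subr0 => ->; rewrite normrM ler_piMl// cos_max.
Qed.

Lemma one_sub_cos_le_sqr y : 1 - cos y <= y ^+ 2 / 2.
Proof.
have -> : cos y = 1 - 2 * sin (y / 2) ^+ 2.
  rewrite [in LHS](_ : y = (y / 2) *+ 2); last by rewrite mulr2n -splitr.
  by rewrite cos_mulr2n cos2sin2; lra.
have : sin (y / 2) ^+ 2 <= (y / 2) ^+ 2.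
  by rewrite -ler_sqrt ?sqr_ge0// !sqrtr_sqr norm_sin_le.
by rewrite expr_div_n; lra.
Qed.

Lemma one_sub_cos_half_gt0 : 0 < 1 - cos (2^-1) :> R.
Proof.
have := @pi_ge2 R => pi2; rewrite subr_gt0 -[ltRHS]cos0 ltr_cos ?in_itv/=; lra.
Qed.

(** Since [pi >= 2], the interval [1/2, 1] lies in [0, pi], where cos decreases. *)
Lemma one_sub_cos_ge y : 2^-1 <= y <= 1 -> 1 - cos (2^-1) <= 1 - cos y.
Proof.
move=> /andP[y1 y2]; have := @pi_ge2 R => pi2; rewrite lerD2l lerN2.
move: y1; rewrite le_eqVlt => /predU1P[->//|y1].
by apply: ltW; rewrite ltr_cos ?in_itv/=; lra.
Qed.

Lemma one_sub_expRN_le y : 1 - expR (- y) <= y.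
Proof. by have := expR_ge1Dx (- y); lra. Qed.

Lemma one_sub_expRN_ge y : 0 <= y <= 1 -> y / 2 <= 1 - expR (- y).
Proof.
move=> /andP[y0 y1]; have e0 := expR_gt0 y.
rewrite expRN; have H : (expR y)^-1 <= (1 + y)^-1.
  by rewrite lef_pV2 ?posrE ?expR_ge1Dx//; lra.
suff : (1 + y)^-1 <= 1 - y / 2 by lra.
by rewrite -div1r ler_pdivrMr; nra.
Qed.

End trigonometry.

Section basis_vector.
Context {R : realType} {n : nat} (i0 : 'I_n).

Definition basis_rV : 'rV[R]_n := \row_j (j == i0)%:R.

Lemma dotvZ_basis (c : R) (x : 'rV[R]_n) : dotv (c *: basis_rV) x = c * x ord0 i0.
Proof.
rewrite /dotv (bigD1 i0)//= big1 ?addr0 => [|j /negPf ji]; rewrite !mxE.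
  by rewrite eqxx mulr1.
by rewrite ji mulr0 mul0r.
Qed.

Lemma enorm_basis : enorm basis_rV = 1.
Proof.
by rewrite /enorm -[basis_rV]scale1r dotvZ_basis !mxE eqxx !mulr1 sqrtr1.
Qed.

End basis_vector.

(** * Geometric sums and telescoping over dyadic scales *)

Lemma sum_expr_le {R : realType} (z : R) N : 0 <= z -> z < 1 ->
  \sum_(k < N) z ^+ k <= (1 - z)^-1.
Proof.
move=> z0 z1; have z10 : 0 < 1 - z by lra.
have : (1 - z) * \sum_(k < N) z ^+ k <= 1.
  by rewrite -opprB mulNr -subrX1 opprB; have := exprn_ge0 N z0; lra.
by rewrite -ler_pdivlMl// mulr1.
Qed.

Lemma exists_expr_le {R : realType} (z e : R) : 0 <= z -> z < 1 -> 0 < e ->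
  exists N, z ^+ N <= e.
Proof.
move=> z0 z1 e0; have : `|z| < 1 by rewrite ger0_norm.
move=> /cvg_expr/cvgrPdist_le/(_ _ e0)[N _ /(_ N (leqnn N))].
by rewrite sub0r normrN ger0_norm ?exprn_ge0// => H; exists N.
Qed.

(** Meant for [G] an integral over a cube and [B] the cost of one dyadic shell: the shells are
    peeled off inwards, leaving a small cube. *)
Lemma telescope_down {R : realType} (G B : R -> R) r N :
  (forall s, 0 < s -> G (2 * s) <= G s + B s) -> 0 < r ->
  G r <= G (r / 2 ^+ N) + \sum_(k < N) B (r / 2 ^+ k.+1).
Proof.
move=> H r0; elim: N => [|N IH]; first by rewrite expr0 divr1 big_ord0 addr0.
rewrite big_ord_recr/= addrA addrAC; apply: le_trans IH _; rewrite lerD2r.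
have := H (r / 2 ^+ N.+1); rewrite divr_gt0// ?exprn_gt0// => /(_ isT).
rewrite (_ : 2 * _ = r / 2 ^+ N)// exprS; field.
by rewrite expf_neq0.
Qed.

Lemma telescope_up {R : realType} (G B : R -> R) r N :
  (forall s, 0 < s -> G (2 * s) <= G s + B s) -> 0 < r ->
  G (2 ^+ N * r) <= G r + \sum_(k < N) B (2 ^+ k * r).
Proof.
move=> H r0; elim: N => [|N IH]; first by rewrite expr0 mul1r big_ord0 addr0.
rewrite big_ord_recr/= addrA exprS -mulrA.
by apply: le_trans (H _ _) _; rewrite ?lerD2r// mulr_gt0// exprn_gt0.
Qed.

(* [weak_scaling] read along the scales 2^k, with up = 2^au and B = 2^-al. *)
Record dyadic_scaling {R : realType} (psi : R -> R) (cl B cu up : R) : Prop := {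
  ds_cl_ge0 : 0 <= cl ;
  ds_B_ge0 : 0 <= B ;
  ds_B_lt1 : B < 1 ;
  ds_cu_gt0 : 0 < cu ;
  ds_up_gt0 : 0 < up ;
  ds_up_lt4 : up < 4 ;
  ds_ge0 : forall a, 0 <= a -> 0 <= psi a ;
  ds_le : forall a b, 0 <= a -> a <= b -> psi a <= psi b ;
  ds_up : forall k a, 0 < a -> psi (2 ^+ k * a) <= cu * up ^+ k * psi a ;
  ds_down : forall k a, 0 < a -> psi a <= cl * B ^+ k * psi (2 ^+ k * a) }.

(** * Density and shell bounds for an isotropic unimodal law *)

Section unimodal_law.
Context {R : realType} {n : nat}.

(* [mu] and [q] are the law and the density at time [t] of a process with
   radial exponent [psi]. *)
Record unimodal_law (psi : R -> R) (t : R) (mu : probability 'rV[R]_n R)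
    (q : 'rV[R]_n -> R) : Prop := {
  ul_density : isotropic_unimodal_density q ;
  ul_origin : forall x, q x <= q 0 ;
  ul_mass : forall A, measurable A ->
    mu A = (\int[lebesgue_rV R n]_(x in A) (q x)%:E)%E ;
  ul_char : forall xi, (\int[mu]_x (1 - cos (dotv xi x))%:E =
    (1 - expR (- (t * psi (enorm xi))))%:E)%E }.

Context {psi : R -> R} {t : R} {mu : probability 'rV[R]_n R}
  {q : 'rV[R]_n -> R}.
Hypotheses (n_gt0 : (0 < n)%N) (L : unimodal_law psi t mu q).

Let rt : R := Num.sqrt n%:R.

Let rt_gt0 : 0 < rt. Proof. by rewrite sqrtr_gt0 ltr0n. Qed.

Let i0 : 'I_n := Ordinal n_gt0.

Let q_ge0 x : 0 <= q x. Proof. by case: (ul_density L). Qed.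

Let mq (D : set 'rV[R]_n) : measurable_fun D (fun x => (q x)%:E).
Proof.
by apply: measurable_funTS; apply/measurable_EFinP; case: (ul_density L).
Qed.

Lemma law_ge A b : measurable A -> 0 <= b -> (forall x, A x -> b <= q x) ->
  (b%:E * lebesgue_rV R n A <= mu A)%E.
Proof.
move=> mA b0 H; rewrite (ul_mass L)// -integral_cst//.
apply: ge0_le_integral => // x Ax; rewrite lee_fin//; exact: H.
Qed.

Lemma law_le A b : measurable A -> (forall x, A x -> q x <= b) -> 0 <= b ->
  (mu A <= b%:E * lebesgue_rV R n A)%E.
Proof.
move=> mA H b0; rewrite (ul_mass L)// -integral_cst//.
apply: ge0_le_integral => // x Ax; rewrite lee_fin//; exact: H.
Qed.

Let kap : R := 1 - cos 2^-1.

Let kap_gt0 : 0 < kap. Proof. exact: one_sub_cos_half_gt0. Qed.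

Lemma measurable_one_sub_cos xi (D : set 'rV[R]_n) :
  measurable_fun D (fun x => (1 - cos (dotv xi x))%:E).
Proof.
apply: measurable_funTS; apply/measurable_EFinP.
apply: measurable_funB => //.
apply: (measurableT_comp (continuous_measurable_fun (@continuous_cos R))).
apply: measurable_sum => i; apply: measurable_funM => //.
exact: measurable_rV_coord.
Qed.

Let enorm_Zbasis (c : R) : 0 <= c -> enorm (c *: basis_rV i0) = c.
Proof. by move=> c0; rewrite enormZ enorm_basis mulr1 ger0_norm. Qed.

(** The numerator is [r ^+ m] over the volume of the box [a/2, a[^m at a = r / sqrt m; the divisor
    is the minimum of [1 - cos] on [1/2, 1]. *)
Definition upper_const (m : nat) : R :=
  (2 * Num.sqrt m%:R) ^+ m / (1 - cos 2^-1).

Lemma upper_const_ge0 m : 0 <= upper_const m.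
Proof.
by rewrite /upper_const divr_ge0 ?exprn_ge0 ?mulr_ge0 ?sqrtr_ge0 ?one_sub_cos_ge0.
Qed.

(* At frequency a^-1 along the first axis, [1 - cos] is bounded below on the
   box [a/2, a[^n, where [q] is at least [q z]. *)
Lemma density_upper z (r : R) : 0 < r -> r <= enorm z ->
  q z * r ^+ n <= upper_const n * (t * psi (rt / r)).
Proof.
move=> r0 rz; pose a := r / rt; have a0 : 0 < a by rewrite divr_gt0.
have qz x : corner a x -> q z <= q x.
  move=> Cx; apply: unimodal_le; [exact: ul_density L|exact: ul_origin L|].
  apply: le_trans (enorm_le_norm _) _; apply: le_trans rz.
  rewrite mulrC -ler_pdivlMr//; apply: norm_rV_le (ltW a0) _ => i.
  by have /andP[? ?] := Cx i; rewrite ger0_norm; lra.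
have := law_ge (@measurable_corner R n a) (q_ge0 z) qz.
rewrite lebesgue_corner// => m1.
have m2 : (kap%:E * mu (corner a) <= (t * psi (rt / r))%:E)%E.
  apply: (@le_trans _ _ (\int[mu]_x (1 - cos (dotv (a^-1 *: basis_rV i0) x))%:E)%E).
    rewrite -integral_cst; last exact: measurable_corner.
    apply: (@le_trans _ _ (\int[mu]_(x in corner a)
        (1 - cos (dotv (a^-1 *: basis_rV i0) x))%:E)%E).
      apply: ge0_le_integral => //.
      - exact: measurable_corner.
      - by move=> x _; rewrite lee_fin ltW.
      - exact: measurable_one_sub_cos.
      - move=> x Cx; rewrite lee_fin one_sub_cos_ge// dotvZ_basis.
        have /andP[? ?] := Cx i0.
        rewrite [_ * x _ _]mulrC ler_pdivlMr ?ler_pdivrMr//; lra.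
    apply: ge0_subset_integral => //.
    - exact: measurable_corner.
    - exact: measurable_one_sub_cos.
  have ia0 : 0 <= a^-1 by rewrite invr_ge0 ltW.
  rewrite (ul_char L) enorm_Zbasis// lee_fin /a invf_div.
  exact: one_sub_expRN_le.
have : (kap%:E * ((q z)%:E * ((a / 2) ^+ n)%:E) <= (t * psi (rt / r))%:E)%E.
  by apply: le_trans m2; rewrite lee_pmul2l// lte_fin.
rewrite -!EFinM lee_fin => H; rewrite /upper_const -/kap -/rt.
rewrite (_ : q z * r ^+ n =
    (2 * rt) ^+ n / kap * (kap * (q z * (a / 2) ^+ n))); last first.
  rewrite /a !expr_div_n exprMn; field.
  by rewrite gt_eqF// expf_neq0 ?gt_eqF// expf_neq0.
by rewrite ler_wpM2l// upper_const_ge0.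
Qed.

Lemma law_shell_le (r b : R) : 0 < r -> 0 <= b -> (forall x, r <= `|x| -> q x <= b) ->
  forall m : R, 0 < m ->
  (mu (cube 0 m `\` cube 0 r) <= (b * (2 * m) ^+ n)%:E)%E.
Proof.
move=> r0 b0 H m m0; have mS : measurable (cube (0 : 'rV[R]_n) m `\` cube 0 r).
  by apply: measurableD; exact: measurable_cube.
apply: le_trans (law_le (b := b) mS _ b0) _.
  by move=> x [_ /negP]; rewrite /cube/= subr0 -leNgt; exact: H.
rewrite EFinM lee_wpmul2l ?lee_fin// -(lebesgue_cube 0 m0).
by apply: le_measure; rewrite ?inE//; exact: measurable_cube.
Qed.

Let shell_const : R := 4 ^+ n * upper_const n.

(** The density bound holds on the shell because the sup norm is at most the Euclidean one; the
    outer cube has side [4 * r], whence the factor [4 ^+ n]. *)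
Lemma law_dyadic_shell (r : R) : 0 < r ->
  (mu (cube 0 (2 * r) `\` cube 0 r) <= (shell_const * (t * psi (rt / r)))%:E)%E.
Proof.
move=> r0; have r20 : 0 < 2 * r by lra.
pose b := upper_const n * (t * psi (rt / r)) / r ^+ n.
have H x : r <= `|x| -> q x <= b.
  move=> rx; rewrite ler_pdivlMr ?exprn_gt0//; apply: density_upper => //.
  exact: le_trans rx (norm_le_enorm _).
have b0 : 0 <= b.
  (* The constant vector [r] lies outside the open cube, so [b] dominates a value of [q]. *)
  apply: le_trans (q_ge0 (const_mx r)) _; apply: H.
  have := norm_coord_le (const_mx r : 'rV[R]_n) i0.
  by rewrite mxE ger0_norm// ltW.
apply: le_trans (law_shell_le r0 b0 H r20) _; rewrite lee_fin.
rewrite /b /shell_const (_ : 2 * (2 * r) = 4 * r); last by lra.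
rewrite exprMn le_eqVlt; apply/orP; left; apply/eqP; field.
by rewrite expf_neq0// gt_eqF.
Qed.

Lemma law_finE A : measurable A -> mu A = (fine (mu A))%:E.
Proof. by move=> mA; rewrite fineK// fin_num_measure. Qed.

Lemma cos_integral_le xi A c : measurable A -> 0 <= c ->
  (forall x, A x -> 1 - cos (dotv xi x) <= c) ->
  (\int[mu]_(x in A) (1 - cos (dotv xi x))%:E <= c%:E * mu A)%E.
Proof.
move=> mA c0 H; rewrite -integral_cst//.
by apply: ge0_le_integral => //; exact: measurable_one_sub_cos.
Qed.

Lemma cos_integral_fin xi A : measurable A ->
  (\int[mu]_(x in A) (1 - cos (dotv xi x))%:E)%E \is a fin_num.
Proof.
move=> mA; rewrite ge0_fin_numE; last first.
  by apply: integral_ge0 => x _; rewrite lee_fin one_sub_cos_ge0.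
have := @cos_integral_le xi A 2 mA (ler0n _ 2).
move=> /(_ (fun _ _ => one_sub_cos_le2 _)) /le_lt_trans; apply.
by rewrite law_finE// -EFinM ltry.
Qed.

(** * Tail bound and lower bound under dyadic scaling *)

Context {cl B cu up : R}.
Hypotheses (t_ge0 : 0 <= t) (S : dyadic_scaling psi cl B cu up).

Let cl_ge0 : 0 <= cl. Proof. by case: S. Qed.
Let B_ge0 : 0 <= B. Proof. by case: S. Qed.
Let B_lt1 : B < 1. Proof. by case: S. Qed.
Let cu_gt0 : 0 < cu. Proof. by case: S. Qed.
Let up_gt0 : 0 < up. Proof. by case: S. Qed.
Let up_lt4 : up < 4. Proof. by case: S. Qed.
Let psi_ge0 (a : R) : 0 <= a -> 0 <= psi a.
Proof. by move=> a0; have [_ _ _ _ _ _ H _ _ _] := S; exact: H. Qed.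
Let psi_le (a b : R) : 0 <= a -> a <= b -> psi a <= psi b.
Proof. by have [_ _ _ _ _ _ _ H _ _] := S; exact: H. Qed.
Let psi_up k (a : R) : 0 < a -> psi (2 ^+ k * a) <= cu * up ^+ k * psi a.
Proof. by have [_ _ _ _ _ _ _ _ H _] := S; exact: H. Qed.
Let psi_dn k (a : R) : 0 < a -> psi a <= cl * B ^+ k * psi (2 ^+ k * a).
Proof. by have [_ _ _ _ _ _ _ _ _ H] := S; exact: H. Qed.

(** After [k] doublings of the scale [psi] has shrunk by the factor [cl * B ^+ k], so the shell
    masses outside [cube 0 r] are dominated by a geometric series. *)
Lemma law_tail (r : R) : 0 < r ->
  (mu (~` cube 0 r) <=
    (shell_const * cl / (1 - B) * (t * psi (rt / r)))%:E)%E.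
Proof.
move=> r0; pose G s := fine (mu (cube 0 s)).
have mC s : 0 < s -> measurable (cube (0 : 'rV[R]_n) s).
  exact: measurable_cube.
have mGE s : 0 < s -> mu (cube 0 s) = (G s)%:E by move=> s0; rewrite law_finE//; exact: mC.
have K0 : 0 <= shell_const by rewrite mulr_ge0 ?exprn_ge0 ?upper_const_ge0.
have p0 : 0 <= psi (rt / r) by rewrite psi_ge0// divr_ge0 ?ltW.
have GS s : 0 < s -> G (2 * s) <= G s + shell_const * (t * psi (rt / s)).
  move=> s0; rewrite -lee_fin EFinD -!mGE ?mulr_gt0//.
  apply: (@le_trans _ _ (mu (cube 0 s) + mu (cube 0 (2 * s) `\` cube 0 s))%E).
    apply: le_trans (measureU2 _ _ _).
    - apply: le_measure; rewrite ?inE.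
      + by apply: mC; rewrite mulr_gt0.
      + apply: measurableU; [exact: mC|apply: measurableD; apply: mC => //].
        by rewrite mulr_gt0.
      + by move=> x xs; have [?|?] := pselect (cube 0 s x); [left|right].
    - exact: mC.
    - by apply: measurableD; apply: mC; rewrite ?mulr_gt0.
  by rewrite leeD2l// law_dyadic_shell.
pose Tl := shell_const * cl / (1 - B) * (t * psi (rt / r)).
have GN N : G (2 ^+ N * r) <= G r + Tl.
  apply: le_trans (telescope_up N GS r0) _; rewrite lerD2l.
  apply: (@le_trans _ _ (\sum_(k < N)
      shell_const * cl * (t * psi (rt / r)) * B ^+ k)).
    apply: ler_sum => k _; have k0 : 0 < 2 ^+ k :> R by rewrite exprn_gt0.
    have := @psi_dn k (rt / (2 ^+ k * r)); rewrite divr_gt0 ?mulr_gt0//.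
    move=> /(_ isT); rewrite (_ : 2 ^+ k * (rt / (2 ^+ k * r)) = rt / r); last first.
      by field; rewrite !gt_eqF.
    move=> H; apply: (@le_trans _ _
      (shell_const * (t * (cl * B ^+ k * psi (rt / r))))).
      by rewrite !ler_wpM2l.
    by rewrite le_eqVlt; apply/orP; left; apply/eqP; ring.
  rewrite -mulr_sumr /Tl mulrAC ler_wpM2r ?mulr_ge0//.
  by rewrite ler_wpM2l ?mulr_ge0 ?sum_expr_le.
(* The cubes exhaust the space, so the bound on [G] passes to the total mass 1. *)
have cvgG : mu (cube 0 (2 ^+ N * r)) @[N --> \oo] --> mu [set: 'rV[R]_n].
  have -> : [set: 'rV[R]_n] = \bigcup_N cube 0 (2 ^+ N * r).
    apply/seteqP; split => // x _.
    have x1 : 0 < 1 + `|x| by rewrite ltr_pwDl.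
    have h0 : 0 <= 2^-1 :> R by lra.
    have h1 : 2^-1 < 1 :> R by lra.
    have [N HN] := exists_expr_le h0 h1 (divr_gt0 r0 x1).
    exists N => //; rewrite /cube/= subr0.
    rewrite exprVn -div1r ler_pdivrMr ?exprn_gt0// in HN.
    rewrite mulrAC ler_pdivlMr ?ltr_pwDl// mul1r mulrC in HN.
    by apply: lt_le_trans HN; lra.
  apply: nondecreasing_cvg_mu => //.
  - by move=> N; apply: mC; rewrite mulr_gt0// exprn_gt0.
  - by apply: bigcup_measurable => N _; apply: mC; rewrite mulr_gt0// exprn_gt0.
  - move=> N1 N2 N12; apply/subsetPset => x; rewrite /cube/= => /lt_le_trans; apply.
    by rewrite ler_pM2r// ler_eXn2l// ltr1n.
have one_le : (1 <= (G r + Tl)%:E)%E.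
  rewrite -(@probability_setT _ _ _ mu) -(cvg_lim _ cvgG)//.
  apply: lime_le; first by apply/cvg_ex; eexists; exact: cvgG.
  by apply: nearW => N; rewrite mGE ?lee_fin// mulr_gt0// exprn_gt0.
rewrite probability_setC; last exact: mC.
by rewrite mGE// -EFinB lee_fin; move: one_le; rewrite lee_fin /Tl; lra.
Qed.

Lemma cos_integral_split xi A C : measurable A -> measurable C -> A `<=` C ->
  (\int[mu]_(x in C) (1 - cos (dotv xi x))%:E =
   \int[mu]_(x in A) (1 - cos (dotv xi x))%:E +
   \int[mu]_(x in C `\` A) (1 - cos (dotv xi x))%:E)%E.
Proof.
move=> mA mC sAC; rewrite -{1}(setDUK sAC) ge0_integral_setU//.
- exact: measurableD.
- exact: measurable_one_sub_cos.
- by rewrite disj_set2E setDIK.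
Qed.

(** On the shell [k] halvings below [r], the quadratic bound on [1 - cos] gains 4^-k while the mass
    bound loses at most [cu * up ^+ k]; as [up < 4], the shells sum geometrically. *)
Lemma cos_integral_cube (sig r : R) : 0 < r -> 0 <= sig ->
  (\int[mu]_(x in cube 0 r) (1 - cos (dotv (sig *: basis_rV i0) x))%:E <=
   (2 * shell_const * cu / (1 - up / 4) * (sig * r) ^+ 2 *
    (t * psi (rt / r)))%:E)%E.
Proof.
move=> r0 sg0; set xi := sig *: _.
have mC s : 0 < s -> measurable (cube (0 : 'rV[R]_n) s).
  exact: measurable_cube.
have K0 : 0 <= shell_const by rewrite mulr_ge0 ?exprn_ge0 ?upper_const_ge0.
have p0 : 0 <= psi (rt / r) by rewrite psi_ge0// divr_ge0 ?ltW.
pose G s := fine (\int[mu]_(x in cube 0 s) (1 - cos (dotv xi x))%:E)%E.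
have GE s : 0 < s ->
    (\int[mu]_(x in cube 0 s) (1 - cos (dotv xi x))%:E)%E = (G s)%:E.
  by move=> s0; rewrite fineK//; apply: cos_integral_fin; exact: mC.
have ptw s x : cube 0 s x -> 1 - cos (dotv xi x) <= (sig * s) ^+ 2 / 2.
  rewrite /cube/= subr0 => xs; apply: le_trans (one_sub_cos_le_sqr _) _.
  rewrite ler_pM2r// dotvZ_basis -real_normK ?num_real// ler_sqr ?nnegrE//.
    by rewrite normrM ger0_norm// ler_wpM2l// (le_trans (norm_coord_le _ _))// ltW.
  by rewrite mulr_ge0// (le_trans _ (ltW xs)).
have GS s : 0 < s ->
    G (2 * s) <= G s + 2 * (sig * s) ^+ 2 * (shell_const * (t * psi (rt / s))).
  move=> s0; have s20 : 0 < 2 * s by lra.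
  rewrite -lee_fin EFinD -!GE// (@cos_integral_split xi (cube 0 s)); last 3 first.
  - exact: mC.
  - exact: mC.
  - by move=> x; rewrite /cube/= => /lt_le_trans; apply; lra.
  rewrite leeD2l//.
  apply: (@le_trans _ _ (((sig * (2 * s)) ^+ 2 / 2)%:E *
    mu (cube 0 (2 * s) `\` cube 0 s))%E).
    apply: cos_integral_le.
    - by apply: measurableD; exact: mC.
    - by rewrite divr_ge0 ?sqr_ge0.
    - by move=> x [xs _]; exact: ptw.
  rewrite (_ : (sig * (2 * s)) ^+ 2 / 2 = 2 * (sig * s) ^+ 2); last by field.
  rewrite [leRHS]EFinM; apply: lee_wpmul2l; last exact: law_dyadic_shell.
  by rewrite lee_fin mulr_ge0 ?sqr_ge0.
rewrite GE// lee_fin; set c := sig * r; set T := _ * _.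
have cu0 := ltW cu_gt0; have r_ge0 := ltW r0.
have up40 : 0 <= up / 4 by rewrite divr_ge0 ?ltW.
have up41 : up / 4 < 1 by rewrite ltr_pdivrMr ?mul1r.
have GN N : G r <= G (r / 2 ^+ N) + T.
  apply: le_trans (telescope_down N GS r0) _; rewrite lerD2l.
  apply: (@le_trans _ _ (\sum_(k < N)
      2 * shell_const * cu * c ^+ 2 * (t * psi (rt / r)) * (up / 4) ^+ k)).
    apply: ler_sum => k _; have k0 : 0 < 2 ^+ k.+1 :> R by rewrite exprn_gt0.
    have := @psi_up k.+1 (rt / r); rewrite divr_gt0// => /(_ isT).
    rewrite (_ : 2 ^+ k.+1 * (rt / r) = rt / (r / 2 ^+ k.+1)); last first.
      by field; rewrite !gt_eqF.
    move=> H; apply: (@le_trans _ _ (2 * (sig * (r / 2 ^+ k.+1)) ^+ 2 *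
        (shell_const * (t * (cu * up ^+ k.+1 * psi (rt / r)))))).
      by rewrite !ler_wpM2l// mulr_ge0 ?sqr_ge0.
    rewrite (_ : 2 * (sig * _) ^+ 2 * _ = 2 * shell_const * cu * c ^+ 2 *
        (t * psi (rt / r)) * (up / 4) ^+ k.+1); last first.
      rewrite expr_div_n (_ : 4 ^+ k.+1 = (2 ^+ k.+1) ^+ 2); last first.
        by rewrite exprAC; congr (_ ^+ _); ring.
      by rewrite /c; field; rewrite gt_eqF.
    rewrite ler_wpM2l ?mulr_ge0 ?sqr_ge0//.
    by rewrite exprS ler_piMl ?exprn_ge0// ltW.
  rewrite -mulr_sumr /T (_ : _ / _ * _ * _ = 2 * shell_const * cu * c ^+ 2 *
    (t * psi (rt / r)) * (1 - up / 4)^-1); last by ring.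
  by rewrite ler_wpM2l ?sum_expr_le// !mulr_ge0.
(* The remaining cube, at scale [r / 2 ^+ N], has mass at most 1, and [1 - cos] there is at most
   4^-N (sig r)^2 / 2, which a large [N] brings down to [e]. *)
apply/ler_addgt0Pr => e e0.
have c1 : 0 < 1 + c ^+ 2 by rewrite ltr_pwDl ?sqr_ge0.
have h0 : 0 <= 4^-1 :> R by lra.
have h1 : 4^-1 < 1 :> R by lra.
have [N HN] := exists_expr_le h0 h1 (divr_gt0 e0 c1).
apply: le_trans (GN N) _; rewrite addrC lerD2l.
have rN0 : 0 < r / 2 ^+ N by rewrite divr_gt0// exprn_gt0.
have : ((G (r / 2 ^+ N))%:E <= ((sig * (r / 2 ^+ N)) ^+ 2 / 2)%:E * 1)%E.
  rewrite -GE//; apply: le_trans (lee_wpmul2l _ (probability_le1 mu (mC _ rN0))).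
    apply: cos_integral_le; [exact: mC| |exact: ptw].
    by rewrite divr_ge0 ?sqr_ge0.
  by rewrite lee_fin divr_ge0 ?sqr_ge0.
rewrite mule1 lee_fin => /le_trans; apply.
rewrite (_ : (sig * _) ^+ 2 / 2 = 4^-1 ^+ N * (c ^+ 2 / 2)); last first.
  rewrite exprVn (_ : 4 ^+ N = (2 ^+ N) ^+ 2); last first.
    by rewrite exprAC; congr (_ ^+ _); ring.
  by rewrite /c; field; rewrite expf_neq0.
apply: (@le_trans _ _ (e / (1 + c ^+ 2) * (1 + c ^+ 2))); last first.
  by rewrite divfK// gt_eqF.
apply: ler_pM => //; rewrite ?exprn_ge0 ?divr_ge0 ?sqr_ge0//.
by have := sqr_ge0 c; lra.
Qed.

Lemma density_lower : exists2 c : R, 0 < c & forall z (r : R), 0 < r ->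
  enorm z <= r -> t * psi (rt / r) <= 1 -> c * (t * psi (rt / r)) <= q z * r ^+ n.
Proof.
pose K1 := shell_const * cl / (1 - B).
pose K2 := 2 * shell_const * cu / (1 - up / 4).
have cu0 := ltW cu_gt0; have rt0 := ltW rt_gt0.
have K0 : 0 <= shell_const by rewrite mulr_ge0 ?exprn_ge0 ?upper_const_ge0.
have up40 : 0 <= up / 4 by rewrite divr_ge0 ?ltW.
have up41 : up / 4 < 1 by rewrite ltr_pdivrMr ?mul1r.
have K10 : 0 <= K1 by rewrite divr_ge0 ?mulr_ge0// subr_ge0 ltW.
have K20 : 0 <= K2.
  by rewrite divr_ge0 ?mulr_ge0// subr_ge0 ltW.
have d1 : 0 < 8 * (cu * K2 * rt ^+ 2 + 1).
  by rewrite mulr_gt0// ltr_wpDl// mulr_ge0 ?sqr_ge0// mulr_ge0.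
(* The small delta in the frequency [sig] is 2^-j. Passing from [sig] back to [rt / r] costs
   [D = cu * up ^+ j], and [j] is such that [D] times the inner part is still at most [a / 8]. *)
have [j] := exists_expr_le up40 up41 (divr_gt0 ltr01 d1).
rewrite ler_pdivlMr// => Hj.
pose D := cu * up ^+ j; have D0 : 0 < D by rewrite mulr_gt0 ?exprn_gt0.
have d2 : 0 < 16 * (D * K1 * cl) + 1.
  by rewrite ltr_wpDl// mulr_ge0// mulr_ge0// mulr_ge0// ltW.
(* [N] puts the outer cut at [2 ^+ N * r], far enough for [D] times the tail term to be at most
   [a / 8]. *)
have [N] := exists_expr_le B_ge0 B_lt1 (divr_gt0 ltr01 d2).
rewrite ler_pdivlMr// => HN.
have c0 : 0 < 8 * D * (2 * 2 ^+ N) ^+ n.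
  by rewrite !mulr_gt0// exprn_gt0// mulr_gt0// exprn_gt0.
exists (8 * D * (2 * 2 ^+ N) ^+ n)^-1; first by rewrite invr_gt0.
move=> z r r0 zr; set a := t * psi (rt / r) => a1.
have th0 : 0 < rt / r by rewrite divr_gt0.
have a0 : 0 <= a by rewrite mulr_ge0// psi_ge0// ltW.
pose sig := rt / r / 2 ^+ j; have jp : 0 < 2 ^+ j :> R by rewrite exprn_gt0.
have sg0 : 0 < sig by rewrite divr_gt0.
pose m := 2 ^+ N * r; have Np : 0 < 2 ^+ N :> R by rewrite exprn_gt0.
have m0 : 0 < m by rewrite mulr_gt0.
have rm : r <= m by rewrite ler_peMl ?(ltW r0)// exprn_ege1// ler1n.
have mCr : measurable (cube (0 : 'rV[R]_n) r) by exact: measurable_cube.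
have mCm : measurable (cube (0 : 'rV[R]_n) m) by exact: measurable_cube.
pose y := t * psi sig; have y0 : 0 <= y by rewrite mulr_ge0// psi_ge0// ltW.
have ya : y <= a.
  rewrite ler_wpM2l// psi_le ?(ltW sg0)// /sig ler_piMr ?(ltW th0)//.
  by rewrite invf_le1// exprn_ege1// ler1n.
have aD : a <= D * y.
  have := @psi_up j sig sg0; rewrite (_ : 2 ^+ j * sig = rt / r); last first.
    by rewrite /sig mulrC divfK// gt_eqF.
  by move=> /(ler_wpM2l t_ge0); rewrite /D /y mulrCA.
have tl : t * psi (rt / m) <= cl * B ^+ N * a.
  have := @psi_dn N (rt / m); rewrite divr_gt0// => /(_ isT).
  rewrite (_ : 2 ^+ N * (rt / m) = rt / r); last by rewrite /m; field; rewrite !gt_eqF.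
  by move=> /(ler_wpM2l t_ge0); rewrite /a [in leRHS]mulrCA.
(* The three terms come from the cube of half-side [r], from the shell up to [m], where [q] is at
   most [q z], and from the tail. *)
have : 1 - expR (- y) <= K2 * (sig * r) ^+ 2 * a + 2 * (q z * (2 * m) ^+ n)
    + 2 * (K1 * (t * psi (rt / m))).
  have := ul_char L (sig *: basis_rV i0); rewrite enorm_Zbasis; last exact: ltW.
  rewrite -/y -lee_fin => <-; rewrite (cos_integral_split _ mCm)//.
  rewrite (cos_integral_split _ mCr)//; last first.
    by move=> x; rewrite /cube/= => /lt_le_trans; apply.
  rewrite !EFinD; apply: leeD; first apply: leeD.
  - by apply: cos_integral_cube => //; exact: ltW.
  - rewrite EFinM; apply: le_trans (lee_wpmul2l _ (law_shell_le (b := q z) r0 _ _ m0)) => //.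
    + apply: cos_integral_le => //; first exact: measurableD.
      by move=> x _; exact: one_sub_cos_le2.
    + move=> x rx; apply: unimodal_le; [exact: ul_density L|exact: ul_origin L|].
      by apply: le_trans zr (le_trans rx (norm_le_enorm _)).
  - rewrite setTD EFinM; apply: le_trans (lee_wpmul2l _ (law_tail m0)) => //.
    apply: cos_integral_le => //; first exact: measurableC.
    by move=> x _; exact: one_sub_cos_le2.
have y1 : 0 <= y <= 1 by rewrite y0 (le_trans ya).
move=> H; have {y1}H1 := le_trans (one_sub_expRN_ge y1) H.
have e1 : D * (K2 * (sig * r) ^+ 2 * a) <= a / 8.
  rewrite (_ : D * _ = (up / 4) ^+ j * (cu * K2 * rt ^+ 2) * a); last first.
    rewrite /D /sig expr_div_n (_ : 4 ^+ j = (2 ^+ j) ^+ 2); last first.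
      by rewrite exprAC; congr (_ ^+ _); ring.
    by field; rewrite !gt_eqF.
  rewrite mulrC ler_wpM2l//.
  by have := exprn_ge0 j up40; lra.
have e2 : D * (2 * (K1 * (t * psi (rt / m)))) <= a / 8.
  apply: (@le_trans _ _ (D * (2 * (K1 * (cl * B ^+ N * a))))).
    by rewrite !ler_wpM2l// ltW.
  rewrite (_ : D * _ = a * (2 * (B ^+ N * (D * K1 * cl)))); last by ring.
  by rewrite ler_wpM2l//; have := exprn_ge0 N B_ge0; lra.
(* Since [a <= D * y] and [y / 2 <= 1 - expR (- y)], the three parts times [D] add up to at least
   [a / 2], of which the inner and outer ones take at most [a / 4]. *)
have e3 : a / 4 <= 2 * D * (q z * (2 * m) ^+ n).
  have := ler_wpM2l (ltW D0) H1; rewrite !mulrDr.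
  lra.
rewrite mulrC ler_pdivrMr//.
rewrite (_ : q z * r ^+ n * _ = 4 * (2 * D * (q z * (2 * m) ^+ n))); last first.
  by rewrite /m !exprMn; ring.
lra.
Qed.

End unimodal_law.

(** Take [lambda = 2 ^+ k]. Solving the lower inequality for [psi theta] brings in the inverses of
    [cl] and of 2^al; [al > 0] puts the decay ratio below 1 and [au < 2] puts the growth ratio below
    4. *)
Lemma weak_scaling_dyadic {R : realType} (psi : R -> R) (al au cl cu : R) :
  (forall a : R, 0 <= a -> 0 <= psi a) ->
  (forall a b : R, 0 <= a -> a < b -> psi a < psi b) ->
  0 < al -> au < 2 -> 0 < cl -> 1 <= cu -> weak_scaling psi al au cl cu ->
  dyadic_scaling psi cl^-1 (2 `^ al)^-1 cu (2 `^ au).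
Proof.
move=> psi0 psi_incr al0 au2 cl0 cu1 H.
have pow (k : nat) (a : R) : (2 ^+ k) `^ a = (2 `^ a) ^+ k.
  by rewrite -!powR_mulrn ?powR_ge0// -!powRrM mulrC.
have k1 k : 1 <= 2 ^+ k :> R by rewrite exprn_ege1// ler1n.
have lt2 (a b : R) : a < b -> 2 `^ a < 2 `^ b.
  move=> ab; rewrite /powR gt_eqF// ltr_expR ltr_pM2r//.
  by rewrite ln_gt0// ltr1n.
split => //.
- by rewrite invr_ge0 ltW.
- by rewrite invf_lt1 ?powR_gt0// -[ltLHS](powRr0 2) lt2.
- exact: lt_le_trans cu1.
- have -> : 4 = 2 `^ 2 :> R by rewrite (powR_mulrn 2)//; ring.
  exact: lt2.
- by move=> a b a0; rewrite le_eqVlt => /predU1P[->//|/(psi_incr _ _ a0)/ltW].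
- by move=> k a a0; have [_] := H _ _ (k1 k) a0; rewrite pow.
- move=> k a a0; have [+ _] := H _ _ (k1 k) a0; rewrite pow => Hk.
  rewrite exprVn -invfM ler_pdivlMl// mulr_gt0// exprn_gt0// powR_gt0//.
Qed.

(** * The law of the process at a fixed time *)

Section process_law.
Context {R : realType} {n : nat} {d : measure_display} {Omega : measurableType d}
  {P : probability Omega R} {X : R -> {RV P >-> 'rV[R]_n}}
  {p : R -> 'rV[R]_n -> R} {Psi : 'rV[R]_n -> R} {psi : R -> R}.
Hypotheses (levyX : isotropic_unimodal_levy_process X p Psi)
  (radial_Psi : forall xi, Psi xi = psi (enorm xi)).

(** The cosine integral is the real part of the characteristic function; the cosine is bounded,
    hence integrable under [P], and can be subtracted from 1. *)
Lemma process_unimodal_law (t : R) : 0 < t ->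
  unimodal_law psi t (distribution P (X t)) (p t).
Proof.
move=> t0; split.
- exact: iul_unimodal levyX _ t0.
- by move=> x; exact: iul_origin levyX _ _ t0.
- by move=> A; exact: iul_density levyX _ _ t0.
move=> xi; rewrite ge0_integral_distribution; last 2 first.
- exact: measurable_one_sub_cos.
- by move=> x; rewrite lee_fin one_sub_cos_ge0.
have mcos : measurable_fun setT (fun w => cos (dotv xi (X t w))).
  apply: (measurableT_comp (continuous_measurable_fun (@continuous_cos R))).
  apply: measurable_sum => i; apply: measurable_funM => //.
  by apply: (measurableT_comp (@measurable_rV_coord R n i)).
have icos : P.-integrable setT (EFin \o (fun w => cos (dotv xi (X t w)))).
  apply: measurable_bounded_integrable => //.
    by rewrite ltey_eq fin_num_measure.
  exists 1; split; first exact: num_real.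
  by move=> M M1 w _; apply: le_trans (ltW M1); exact: cos_max.
rewrite (eq_integral (fun w => 1%:E - (cos (dotv xi (X t w)))%:E))%E//.
rewrite integralB_EFin//; last first.
  exact: finite_measure_integrable_cst.
rewrite integral_cst// [X in (1 * X)%E](@probability_setT _ _ _ P) mule1.
have /(congr1 (@complex.Re R)) := iul_charfun levyX xi t0.
rewrite /charfun/= /Rintegral -radial_Psi EFinB => <-.
by rewrite fineK// integrable_fin_num.
Qed.

End process_law.

(** * Positivity of the density and comparison across times *)

Section comparison.
Context {R : realType} {n : nat} {psi : R -> R} {cl B cu up : R}.
Hypotheses (n_gt0 : (0 < n)%N) (S : dyadic_scaling psi cl B cu up)
  (psi_gt0 : forall a, 0 < a -> 0 < psi a).

Let rt : R := Num.sqrt n%:R.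

Let rt_ge1 : 1 <= rt.
Proof. by rewrite -sqrtr1 ler_wsqrtr// ler1n. Qed.

Let rt_gt0 : 0 < rt. Proof. exact: lt_le_trans rt_ge1. Qed.

Let rt_le : rt <= 2 ^+ n.
Proof.
apply: (@le_trans _ _ n%:R); last by rewrite -natrX ler_nat ltnW// ltn_expl.
rewrite -[leRHS]sqr_sqrtr// expr2 ler_peMr// ?rt_ge1 ltW//.
Qed.

(** [psi] decays geometrically along [rt / 2 ^+ N]. The resulting [r] is a scale at which the lower
    density bound is available at time [t]. *)
Lemma exists_small_exponent (t : R) : 0 < t ->
  exists2 r, 0 < r & t * psi (rt / r) <= 1.
Proof.
move=> t0; have cp : 0 < t * cl * psi rt + 1.
  by rewrite ltr_wpDl// !mulr_ge0 ?(ds_cl_ge0 S) ?ltW// psi_gt0.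
have [N] := exists_expr_le (ds_B_ge0 S) (ds_B_lt1 S) (divr_gt0 ltr01 cp).
rewrite ler_pdivlMr// => HN.
have N0 : 0 < 2 ^+ N :> R by rewrite exprn_gt0.
exists (2 ^+ N) => //.
have := @ds_down _ _ _ _ _ _ S N (rt / 2 ^+ N); rewrite divr_gt0// => /(_ isT).
rewrite (_ : 2 ^+ N * _ = rt); last by rewrite mulrC divfK// gt_eqF.
move=> /(ler_wpM2l (ltW t0)) /le_trans; apply.
rewrite (_ : t * (cl * B ^+ N * psi rt) = B ^+ N * (t * cl * psi rt)).
  2: by ring.
by have := exprn_ge0 N (ds_B_ge0 S); lra.
Qed.

(** Enlarging [r] keeps the exponent at most 1, so the lower bound reaches a radius beyond any given
    [z]. *)
Lemma density_gt0 (t : R) mu (q : 'rV[R]_n -> R) z : 0 < t ->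
  unimodal_law psi t mu q -> 0 < q z.
Proof.
move=> t0 L; have [c c0 H] := density_lower n_gt0 L (ltW t0) S.
have [r r0 tr] := exists_small_exponent t0.
pose m := r + enorm z; have m0 : 0 < m by rewrite ltr_pwDl// enorm_ge0.
have rm0 : 0 < rt / m by rewrite divr_gt0.
have zm : enorm z <= m by rewrite lerDr ltW.
have tm : t * psi (rt / m) <= 1.
  apply: le_trans tr; rewrite ler_wpM2l ?(ltW t0)// (ds_le S)// ?(ltW rm0)//.
  by rewrite ler_pM2l// lef_pV2// lerDl enorm_ge0.
have := H z m m0 zm tm; have : 0 < c * (t * psi (rt / m)).
  by rewrite !mulr_gt0// psi_gt0.
by move=> /lt_le_trans /[apply]; rewrite pmulr_lgt0// exprn_gt0.
Qed.

(* For large [z] the lower bound at time [T] matches the upper bound at the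
   earlier time [t]. *)
Lemma density_compare (T r : R) muT (qT : 'rV[R]_n -> R) : 0 < T -> 0 < r ->
  T * psi (rt / r) <= 1 -> unimodal_law psi T muT qT ->
  exists2 K : R, 0 < K & forall t mu q, 0 < t -> t <= T ->
    unimodal_law psi t mu q ->
    forall z w : 'rV[R]_n, r <= `|z| -> `|w| <= 2 * `|z| -> q z <= K * qT w.
Proof.
move=> T0 r0 Tr LT; have [c c0 H] := density_lower n_gt0 LT (ltW T0) S.
pose U := upper_const n : R.
have U0 : 0 <= U by exact: upper_const_ge0.
have cu0 := ds_cu_gt0 S; have up0 := ds_up_gt0 S.
(* In order: the upper constant, the scaling loss over [n.+1] doublings, the inverse of the lower
   constant, and (m / |z|)^n for the radius [m] below. *)
pose K := U * (cu * up ^+ n.+1) / c * (2 * rt) ^+ n.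
have K0 : 0 <= K.
  apply: mulr_ge0; last by rewrite exprn_ge0// mulr_ge0// ltW.
  apply: divr_ge0 (ltW c0); apply: mulr_ge0 => //.
  by rewrite mulr_ge0 ?exprn_ge0// ltW.
exists (K + 1) => [|t mu q t0 tT L z w rz wz]; first by rewrite ltr_wpDl.
have z0 : 0 < `|z| by exact: lt_le_trans rz.
pose m := 2 * rt * `|z|; have m0 : 0 < m by rewrite !mulr_gt0.
have rm0 : 0 < rt / m by rewrite divr_gt0.
have rtm : rt / m = (2 * `|z|)^-1 by rewrite /m; field; rewrite !gt_eqF.
have wm : enorm w <= m.
  apply: le_trans (enorm_le_norm _) _; rewrite /m mulrAC mulrC.
  by rewrite ler_wpM2r// ltW.
have Tm : T * psi (rt / m) <= 1.
  apply: le_trans Tr; rewrite ler_wpM2l ?(ltW T0)// (ds_le S)// ?(ltW rm0)//.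
  rewrite ler_pM2l// lef_pV2// /m; apply: le_trans rz _.
  by rewrite ler_peMl// ?(ltW z0)//; have := rt_ge1; lra.
have lower := H w m m0 wm Tm.
have upper := density_upper n_gt0 L z0 (norm_le_enorm z).
have qw : 0 <= qT w by apply: ltW; exact: density_gt0 LT.
have pm0 : 0 <= psi (rt / m) by rewrite ltW// psi_gt0.
(* As rt / m = 1 / (2 |z|) and [rt <= 2 ^+ n], [n.+1] doublings of [rt / m] reach at least rt /
   |z|. *)
have scale : t * psi (rt / `|z|) <= T * (cu * up ^+ n.+1 * psi (rt / m)).
  apply: ler_pM; rewrite ?(ltW t0)//.
    by rewrite ltW// psi_gt0// divr_gt0.
  apply: le_trans (ds_up S n.+1 rm0); apply: (ds_le S).
    by rewrite ltW// divr_gt0.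
  rewrite rtm exprS invfM mulrA ler_pM2r ?invr_gt0//.
  by rewrite mulrAC mulfV// mul1r.
have zn0 : 0 < `|z| ^+ n by rewrite exprn_gt0.
rewrite -(ler_pM2r zn0); apply: le_trans upper _; rewrite -/U.
apply: (@le_trans _ _ (K * qT w * `|z| ^+ n)); last first.
  by rewrite ler_pM2r// ler_wpM2r// lerDl.
apply: le_trans (ler_wpM2l U0 scale) _.
rewrite (_ : U * _ = U * (cu * up ^+ n.+1) / c * (c * (T * psi (rt / m)))); last first.
  by field; rewrite gt_eqF.
rewrite (_ : K * _ * _ = U * (cu * up ^+ n.+1) / c * (qT w * m ^+ n)); last first.
  by rewrite /K /m !exprMn; ring.
apply: ler_wpM2l lower; apply: divr_ge0 (ltW c0); apply: mulr_ge0 => //.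
by rewrite mulr_ge0 ?exprn_ge0// ltW.
Qed.

End comparison.

(** * Unimodal densities as approximate identities *)

Section approximate_identity.
Context {R : realType} {n : nat} {psi : R -> R} {t : R}
  {mu : probability 'rV[R]_n R} {q : 'rV[R]_n -> R}.
Hypothesis L : unimodal_law psi t mu q.
Implicit Types x : 'rV[R]_n.

Let q_ge0 x : 0 <= q x. Proof. by case: (ul_density L). Qed.

Lemma measurable_density_subl x (D : set 'rV[R]_n) :
  measurable_fun D (fun y => q (x - y)).
Proof.
apply: measurable_funTS; apply: (measurableT_comp (iud_measurable (ul_density L))).
exact: measurable_rV_subl.
Qed.

(** Links integrals of the kernel [q (x - y)] in [y] to the law [mu], through the reflection
    invariance of Lebesgue measure. *)
Lemma integral_density_subl x A : measurable A ->
  (\int[lebesgue_rV R n]_(y in (fun y => x - y)%R @^-1` A) (q (x - y))%:E = mu A)%E.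
Proof.
move=> mA; rewrite (ul_mass L)//.
transitivity (\int[pushforward (lebesgue_rV R n) (fun y : 'rV[R]_n => x - y)%R]_(y in A)
    (q y)%:E)%E.
  rewrite ge0_integral_pushforward//.
  - exact: measurable_rV_subl.
  - apply: measurable_funTS; apply/measurable_EFinP.
    exact: iud_measurable (ul_density L).
  - by move=> y _; rewrite lee_fin.
apply: eq_measure_integral => //= [|? C mC _]; first exact: measurable_rV_subl.
exact: (lebesgue_rV_subl x mC).
Qed.

Let integrable_density_subl x :
  (lebesgue_rV R n).-integrable setT (EFin \o (fun y : 'rV[R]_n => q (x - y))).
Proof.
apply/integrableP; split.
  by apply/measurable_EFinP; exact: measurable_density_subl.
rewrite (eq_integral (fun y : 'rV[R]_n => (q (x - y))%:E)) => [|y _]; last first.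
  by rewrite /= ger0_norm.
by have := integral_density_subl x measurableT; rewrite preimage_setT => ->;
  rewrite probability_setT ltry.
Qed.

Context {f : 'rV[R]_n -> R} {M : R}.
Hypotheses (mf : measurable_fun setT f) (fM : forall y, `|f y| <= M).

Lemma integrable_density_subl_mul x :
  (lebesgue_rV R n).-integrable setT (EFin \o (fun y : 'rV[R]_n => q (x - y) * f y)).
Proof.
apply: (@le_integrable _ _ _ _ _ measurableT _
    (fun y : 'rV[R]_n => M%:E * (EFin \o (fun y : 'rV[R]_n => q (x - y))) y)%E).
- apply/measurable_EFinP; apply: measurable_funM => //.
  exact: measurable_density_subl.
- move=> y _ /=; rewrite lee_fin mulrC !normrM ler_wpM2r//.
  exact: le_trans (fM y) (ler_norm M).
- exact: integrableZl.
Qed.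

(** As [q] has mass 1, [f x] is itself an integral against [q (x - y)]. Near [x] the integrands
    differ by at most [e] times the density, elsewhere by at most [2 * M] times it. *)
Lemma approximate_identity x (e dl : R) : 0 <= e -> 0 < dl ->
  (forall y, `|y - x| < dl -> `|f y - f x| <= e) ->
  (`|\int[lebesgue_rV R n]_y (q (x - y) * f y)%:E - (f x)%:E| <=
     e%:E + (2 * M)%:E * mu (~` cube 0 dl))%E.
Proof.
move=> e0 dl0 H; have M0 : 0 <= M by exact: le_trans (fM x).
have mC : measurable (cube x dl) by exact: measurable_cube.
have pC : (fun y => x - y) @^-1` cube 0 dl = cube x dl.
  by apply/seteqP; split => y; rewrite /cube/= subr0 distrC.
have -> : (f x)%:E = (\int[lebesgue_rV R n]_y (q (x - y) * f x)%:E)%E.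
  under eq_integral do rewrite mulrC EFinM.
  rewrite integralZl//; last exact: integrable_density_subl.
  have := integral_density_subl x measurableT; rewrite preimage_setT => ->.
  by rewrite probability_setT mule1.
have ifx : (lebesgue_rV R n).-integrable setT
    (EFin \o (fun y : 'rV[R]_n => q (x - y) * f x)).
  rewrite (_ : _ \o _ = fun y : 'rV[R]_n =>
      (f x)%:E * (EFin \o (fun y : 'rV[R]_n => q (x - y))) y)%E.
    exact: integrableZl.
  by apply/funext => y /=; rewrite mulrC EFinM.
have /= <- := integralB_EFin measurableT (integrable_density_subl_mul x) ifx.
have mB (D : set 'rV[R]_n) :
    measurable_fun D (fun y : 'rV[R]_n => ((q (x - y) * f y)%:E - (q (x - y) * f x)%:E)%E).
  apply: measurable_funTS; apply: emeasurable_funB.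
    exact: measurable_int (integrable_density_subl_mul x).
  exact: measurable_int ifx.
apply: le_trans (le_abse_integral _ measurableT (mB _)) _.
rewrite -(setUv (cube x dl)) ge0_integral_setU//; last 3 first.
- exact: measurableC.
- by rewrite setUv; exact: measurableT_comp (mB _).
- by rewrite disj_set2E setICr.
have part (D : set 'rV[R]_n) c : measurable D -> 0 <= c ->
    (forall y, D y -> `|f y - f x| <= c) ->
    (\int[lebesgue_rV R n]_(y in D)
       `|(q (x - y) * f y)%:E - (q (x - y) * f x)%:E|
     <= c%:E * \int[lebesgue_rV R n]_(y in D) (q (x - y))%:E)%E.
  move=> mD c0 Hc; rewrite -ge0_integralZl_EFin//; last 2 first.
  - by move=> y _; rewrite lee_fin.
  - by apply/measurable_EFinP; exact: measurable_density_subl.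
  apply: ge0_le_integral => //.
  - exact: measurableT_comp (mB _).
  - apply/measurable_EFinP; apply: measurable_funM => //.
    exact: measurable_density_subl.
  - move=> y Dy; rewrite -EFinB -mulrBr -EFinM lee_fin normrM ger0_norm// mulrC.
    by rewrite ler_wpM2r// Hc.
apply: leeD.
  apply: le_trans (part _ e mC e0 _) _; first by move=> y; exact: H.
  rewrite -pC integral_density_subl; last exact: measurable_cube.
  rewrite -[leRHS]mule1 lee_wpmul2l ?lee_fin//.
  by apply: probability_le1; exact: measurable_cube.
apply: le_trans (part _ (2 * M) _ _ _) _.
- exact: measurableC.
- by rewrite mulr_ge0.
- move=> y _; apply: le_trans (ler_normB _ _) _.
  by have := fM x; have := fM y; lra.
rewrite -pC preimage_setC integral_density_subl//.
by apply: measurableC; exact: measurable_cube.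
Qed.

End approximate_identity.

(** * Unimodal kernels near their center and the maximal function *)

Section maximal_function.
Context {R : realType} {n : nat}.
Hypothesis n_gt0 : (0 < n)%N.
Context {f : 'rV[R]_n -> \bar R} {x : 'rV[R]_n} {g : R}.
Hypotheses (mf : measurable_fun setT f) (f_ge0 : forall y, (0 <= f y)%E).

Let M := local_maximal g f x.

Let rt : R := Num.sqrt n%:R.

Let rt_gt0 : 0 < rt. Proof. by rewrite sqrtr_gt0 ltr0n. Qed.

Lemma local_maximal_ge0 : 0 < g -> (0 <= M)%E.
Proof.
move=> g0; apply: (@le_trans _ _ ((lebesgue_rV R n (eball x (g / 2)))^-1 *
    \int[lebesgue_rV R n]_(y in eball x (g / 2)) `|f y|)%E).
  by rewrite mule_ge0// ?inve_ge0//; apply: integral_ge0 => y _; exact: abse_ge0.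
apply: ereal_sup_ubound; exists (g / 2) => //=; rewrite in_itv/=; lra.
Qed.

Lemma integral_eball_le s : 0 < s -> s < g ->
  (\int[lebesgue_rV R n]_(y in eball x s) f y <= ((2 * s) ^+ n)%:E * M)%E.
Proof.
move=> s0 sg; have M0 : (0 <= M)%E by apply: local_maximal_ge0; exact: lt_trans sg.
have v0 := lebesgue_eball_gt0 x n_gt0 s0; have v1 := lebesgue_eball_le x s0.
have vfin : lebesgue_rV R n (eball x s) \is a fin_num.
  by rewrite ge0_fin_numE// (le_lt_trans v1)// ltry.
apply: (@le_trans _ _ (lebesgue_rV R n (eball x s) * M)%E); last first.
  by rewrite lee_wpmul2r.
have fv0 : 0 < fine (lebesgue_rV R n (eball x s)).
  by rewrite -lte_fin fineK.
rewrite -(fineK vfin) -lee_pdivrMl//.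
have : ((lebesgue_rV R n (eball x s))^-1 *
    \int[lebesgue_rV R n]_(y in eball x s) `|f y| <= M)%E.
  by apply: ereal_sup_ubound; exists s => //=; rewrite in_itv/= s0.
rewrite (eq_integral f) => [|y _]; last by rewrite gee0_abs.
by rewrite -[X in (X^-1 * _)%E](fineK vfin) inver gt_eqF.
Qed.

Context {psi : R -> R} {t : R} {mu : probability 'rV[R]_n R}
  {q : 'rV[R]_n -> R}.
Hypothesis L : unimodal_law psi t mu q.

Let q_ge0 z : 0 <= q z. Proof. by case: (ul_density L). Qed.

Lemma measurable_density_mul (D : set 'rV[R]_n) :
  measurable_fun D (fun y => (q (x - y))%:E * f y)%E.
Proof.
apply: emeasurable_funM; last exact: measurable_funTS.
by apply/measurable_EFinP; exact: measurable_density_subl L _ _.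
Qed.

Let J s : \bar R := (\int[lebesgue_rV R n]_(y in cube x s) ((q (x - y))%:E * f y))%E.

(** The cube lies in the ball of radius [rt * s], which must be admissible in the maximal function,
    hence [rt * s < g]. *)
Let J_le b s : 0 < s -> rt * s < g -> 0 <= b ->
  forall D, measurable D -> D `<=` cube x s -> (forall y, D y -> q (x - y) <= b) ->
  (\int[lebesgue_rV R n]_(y in D) ((q (x - y))%:E * f y) <=
    (b * (2 * (rt * s)) ^+ n)%:E * M)%E.
Proof.
move=> s0 sg b0 D mD Ds H; have rs0 : 0 < rt * s by rewrite mulr_gt0.
apply: (@le_trans _ _ (\int[lebesgue_rV R n]_(y in D) (b%:E * f y))%E).
  apply: ge0_le_integral => //.
  - by move=> y _; rewrite mule_ge0// lee_fin.
  - exact: measurable_density_mul.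
  - by apply: measurable_funeM; exact: measurable_funTS.
  - by move=> y Dy; rewrite lee_wpmul2r// lee_fin H.
rewrite ge0_integralZl_EFin//; last exact: measurable_funTS.
rewrite EFinM -muleA lee_wpmul2l ?lee_fin//.
apply: le_trans (integral_eball_le rs0 sg).
apply: ge0_subset_integral => //; first exact: measurable_eball.
  exact: measurable_funTS.
by move=> y /Ds; exact: cube_sub_eball.
Qed.

(* The shell between the cubes of half-sides [s] and [2 * s] costs at most the
   mass of a smaller shell, and these smaller shells telescope. *)
Let J_shell s : 0 < s -> rt * (2 * s) < g ->
  (J (2 * s) <= J s + ((8 * n%:R) ^+ n *
    (fine (mu (cube 0 (s / rt))) - fine (mu (cube 0 (s / rt / 2)))))%:E * M)%E.
Proof.
move=> s0 sg; have s20 : 0 < 2 * s by rewrite mulr_gt0.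
have M0 : (0 <= M)%E by apply: local_maximal_ge0; apply: lt_trans sg; rewrite mulr_gt0.
(* [q v] mediates between the shells: it bounds [q (x - y)] from above off [cube x s], and [q] from
   below on [corner (s / rt)]. *)
have [v vs] := exists_enorm n_gt0 (ltW s0).
have cs : cube x s `<=` cube x (2 * s).
  by move=> y; rewrite /cube/= => /lt_le_trans; apply; lra.
have mC r : 0 < r -> measurable (cube x r) by exact: measurable_cube.
have mC0 r : 0 < r -> measurable (cube (0 : 'rV[R]_n) r) by exact: measurable_cube.
rewrite /J -(setDUK cs) ge0_integral_setU//; last 5 first.
- exact: mC.
- by apply: measurableD; exact: mC.
- exact: measurable_density_mul.
- by move=> y _; rewrite mule_ge0// lee_fin.
- by rewrite disj_set2E setDIK.
rewrite leeD2l//.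
apply: le_trans (@J_le (q v) (2 * s) s20 sg (q_ge0 v) _ _ _ _) _.
- by apply: measurableD; exact: mC.
- exact: subIsetl.
- move=> y [_ /negP]; rewrite /cube/= -leNgt => sy.
  apply: unimodal_le; [exact: ul_density L|exact: ul_origin L|].
  by rewrite vs (le_trans sy)// distrC norm_le_enorm.
rewrite lee_wpmul2r// lee_fin.
pose a := s / rt; have a0 : 0 < a by rewrite divr_gt0.
have a20 : 0 < a / 2 by rewrite divr_gt0.
have : (((q v) * (a / 2) ^+ n)%:E <= mu (cube 0 a `\` cube 0 (a / 2)))%E.
  rewrite EFinM -lebesgue_corner//.
  apply: (@le_trans _ _ (mu (corner a))).
    apply: (law_ge L) => //; first exact: measurable_corner.
    move=> y Cy; apply: unimodal_le; [exact: ul_density L|exact: ul_origin L|].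
    rewrite vs; apply: le_trans (enorm_le_norm _) _.
    rewrite mulrC -ler_pdivlMr//; apply: norm_rV_le (ltW a0) _ => i.
    by have /andP[? ?] := Cy i; rewrite ger0_norm; lra.
  apply: le_measure; rewrite ?inE.
  - exact: measurable_corner.
  - by apply: measurableD; exact: mC0.
  - move=> y Cy; split; rewrite /cube/= subr0.
      by apply/norm_rV_lt => // i; have /andP[? ?] := Cy i; rewrite ger0_norm; lra.
    apply/negP; rewrite -leNgt.
    apply: le_trans (norm_coord_le y (Ordinal n_gt0)).
    by have /andP[? ?] := Cy (Ordinal n_gt0); rewrite ger0_norm; lra.
rewrite measureD; last 3 first.
- exact: mC0.
- exact: mC0.
- by rewrite ltey_eq fin_num_measure//; exact: mC0.
rewrite setIidr; last by move=> y; rewrite /cube/= => /lt_le_trans; apply; lra.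
move=> H0; have H : q v * (a / 2) ^+ n <=
    fine (mu (cube 0 a)) - fine (mu (cube 0 (a / 2))).
  by rewrite -lee_fin EFinB -(law_finE (mC0 _ a0)) -(law_finE (mC0 _ a20)).

apply: le_trans (ler_wpM2l _ H); last by rewrite exprn_ge0// mulr_ge0.
(* The bases agree: [2 * (rt * (2 * s))] is [8 * n * (a / 2)], because [a = s / rt] and
   [rt ^+ 2 = n]. *)
rewrite le_eqVlt; apply/orP; left; apply/eqP.
rewrite [RHS]mulrCA -exprMn; congr (_ * _ ^+ _); rewrite /a.
rewrite -[n%:R in RHS](@sqr_sqrtr R)// -/rt; field.
by rewrite gt_eqF.
Qed.

(** The shell costs telescope to a difference of two cube masses, at most 1 for any law, so the
    constant depends on the dimension only. *)
Lemma integral_cube_le_maximal r : 0 < r -> rt * r < g ->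
  (J r <= ((8 * n%:R) ^+ n)%:E * M)%E.
Proof.
move=> r0 rg; have g0 : 0 < g by apply: lt_trans rg; rewrite mulr_gt0.
have M0 := local_maximal_ge0 g0; rewrite -/M in M0.
have C0 : 0 < (8 * n%:R) ^+ n :> R by rewrite exprn_gt0// mulr_gt0// ltr0n.
(* An infinite maximal function makes the bound trivial, its factor being positive. *)
move: M0; case EM : M => [m| |]//; last by rewrite gt0_muley ?leey ?lte_fin.
rewrite lee_fin => m0; pose a := r / 2 / rt; pose F s := fine (mu (cube 0 s)).
have J0 s : (0 <= J s)%E.
  by apply: integral_ge0 => y _; rewrite mule_ge0// lee_fin.
have half k : r / 2 ^+ k.+1 = r / 2 ^+ k / 2 by rewrite exprS invfM mulrA mulrAC.
have JN N : (J r <= J (r / 2 ^+ N) +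
    ((8 * n%:R) ^+ n * (F a - F (a / 2 ^+ N)) * m)%:E)%E.
  elim: N => [|N IH].
    by rewrite expr0 !divr1 subrr mulr0 mul0r adde0.
  have p0 k : 0 < r / 2 ^+ k by rewrite divr_gt0// exprn_gt0.
  apply: (le_trans IH).
  have := @J_shell (r / 2 ^+ N.+1) (p0 _); rewrite -/M EM.
  rewrite (_ : 2 * (r / 2 ^+ N.+1) = r / 2 ^+ N); last by rewrite half; field.
  have -> : rt * (r / 2 ^+ N) < g.
    apply: le_lt_trans rg; rewrite ler_pM2l// ler_pdivrMr ?exprn_gt0//.
    by rewrite ler_peMr ?(ltW r0)// exprn_ege1// ler1n.
  rewrite (_ : r / 2 ^+ N.+1 / rt = a / 2 ^+ N); last first.
    by rewrite exprS /a; field; rewrite expf_neq0//= gt_eqF.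
  rewrite (_ : a / 2 ^+ N / 2 = a / 2 ^+ N.+1); last first.
    by rewrite exprS; field; rewrite expf_neq0.
  move=> /(_ isT) H; rewrite -EFinM in H.
  apply: le_trans (leeD H (lexx _)) _; rewrite -addeA leeD2l// -EFinD lee_fin.
  by rewrite /F le_eqVlt; apply/orP; left; apply/eqP; ring.
have Fa1 s : 0 < s -> 0 <= F s <= 1.
  move=> s0; have mC : measurable (cube (0 : 'rV[R]_n) s) by exact: measurable_cube.
  rewrite -!lee_fin /F -(law_finE mC); apply/andP; split => //.
  exact: probability_le1.
have a0 : 0 < a by rewrite !divr_gt0.
apply/lee_addgt0Pr => e e0.
pose b := q 0 * (2 * rt * r) ^+ n * m.
have b0 : 0 <= b by rewrite !mulr_ge0// exprn_ge0// !mulr_ge0// ltW.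
have h0 : 0 <= 2^-1 :> R by lra.
have h1 : 2^-1 < 1 :> R by lra.
have b1 : 0 < b + 1 by lra.
have [N] := exists_expr_le h0 h1 (divr_gt0 e0 b1).
rewrite ler_pdivlMr// => HN.
have N0 : 0 < 2 ^+ N :> R by rewrite exprn_gt0.
have rN0 : 0 < r / 2 ^+ N by rewrite divr_gt0.
(* The kernel is at most [q 0], so the innermost cube costs at most 2^(-N n) b, and [n > 0] makes
   this at most 2^-N b. *)
have JrN : (J (r / 2 ^+ N) <= e%:E)%E.
  have mC : measurable (cube x (r / 2 ^+ N)) by exact: measurable_cube.
  have := @J_le (q 0) (r / 2 ^+ N) rN0 _ (q_ge0 0) _ mC (@subset_refl _ _)
    (fun y _ => ul_origin L _).
  rewrite -/M EM.
  have -> : rt * (r / 2 ^+ N) < g.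
    apply: le_lt_trans rg; rewrite ler_pM2l// ler_pdivrMr//.
    by rewrite ler_peMr ?(ltW r0)// exprn_ege1// ler1n.
  move=> /(_ isT) /le_trans; apply; rewrite -EFinM lee_fin.
  apply: le_trans HN; rewrite (_ : q 0 * _ * m = 2^-1 ^+ N ^+ n * b); last first.
    rewrite /b (_ : 2 * (rt * (r / 2 ^+ N)) = 2^-1 ^+ N * (2 * rt * r)).
      by rewrite exprMn; ring.
    by rewrite exprVn; ring.
  apply: ler_pM => //; last by lra.
  rewrite -[leRHS]expr1; apply: ler_wiXn2l => //.
  by apply: exprn_ile1 => //; lra.
apply: le_trans (JN N) _; rewrite addeC leeD// lee_fin -mulrA.
have /andP[? ?] := Fa1 _ a0; have /andP[? ?] := Fa1 _ (divr_gt0 a0 N0).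
rewrite ler_wpM2l ?(ltW C0)// ler_piMl//; lra.
Qed.

End maximal_function.

(** * The heat kernel properties for a family of unimodal laws *)

Section heat_kernel_properties.
Context {R : realType} {n : nat} {psi : R -> R} {cl B cu up : R}
  {p : R -> 'rV[R]_n -> R} {mu : R -> probability 'rV[R]_n R}.
Hypotheses (n_gt0 : (0 < n)%N) (S : dyadic_scaling psi cl B cu up)
  (psi_gt0 : forall a, 0 < a -> 0 < psi a)
  (L : forall t, 0 < t -> unimodal_law psi t (mu t) (p t)).

Let rt : R := Num.sqrt n%:R.

Let rt_gt0 : 0 < rt. Proof. by rewrite sqrtr_gt0 ltr0n. Qed.

Lemma compactly_supported_bounded (f : 'rV[R]_n -> R) :
  continuous f -> compactly_supported f -> exists M, forall y, `|f y| <= M.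
Proof.
move=> cf /(continuous_compact (continuous_subspaceT cf))/compact_bounded.
move=> [M [_ HM]]; exists (`|M| + 1) => y.
have [->|fy] := eqVneq (f y) 0; first by rewrite normr0.
apply: HM; first by rewrite (le_lt_trans (ler_norm M))// ltrDl.
by exists y => //; exact: subset_closure.
Qed.

(** At a fixed radius the tail bound is linear in [t], so the error away from [x] vanishes; near [x]
    continuity of [f] controls it. *)
Lemma heat_kernel_cvg (f : 'rV[R]_n -> R) x :
  continuous f -> compactly_supported f ->
  (\int[lebesgue_rV R n]_y (p t (x - y) * f y)%:E)%E @[t --> 0^'+]
    --> (f x)%:E.
Proof.
move=> cf sf; have [M fM] := compactly_supported_bounded cf sf.
have mf := continuous_measurable_rV cf.
have M0 : 0 <= M by exact: le_trans (fM x).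
have Ffin t : 0 < t ->
    (\int[lebesgue_rV R n]_y (p t (x - y) * f y)%:E)%E \is a fin_num.
  move=> t0; apply: integrable_fin_num => //.
  exact: (integrable_density_subl_mul (L t0) mf fM).
apply: cvg_EFin; first by near=> t; apply: Ffin.
apply/cvgrPdist_le => e e0.
have /cvgrPdist_le/(_ (e / 2)) := cf x; rewrite divr_gt0// => /(_ isT).
move=> /nbhs_ballP[dl /= dl0 Hdl].
have Hf y : `|y - x| < dl -> `|f y - f x| <= e / 2.
  by move=> yx; rewrite distrC; apply: Hdl; rewrite -ball_normE /= distrC.
(* The bound of [law_tail] at radius [dl], without its factor [t]. *)
pose K := 4 ^+ n * upper_const n * cl / (1 - B) * psi (rt / dl).
have K0 : 0 <= K.
  rewrite mulr_ge0 ?(ltW (psi_gt0 _)) ?divr_gt0// divr_ge0//.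
    by rewrite !mulr_ge0 ?exprn_ge0 ?upper_const_ge0 ?(ds_cl_ge0 S).
  by rewrite subr_ge0 ltW// (ds_B_lt1 S).
have c0 : 0 < 2 * M * K + 1 by rewrite ltr_wpDl// mulr_ge0// mulr_ge0.
near=> t; have t0 : 0 < t by [].
have := approximate_identity (L t0) mf fM (ltW (divr_gt0 e0 (ltr0n _ 2))) dl0 Hf.
rewrite -(fineK (Ffin _ t0)) -EFinB abse_EFin distrC /= => /le_trans H.
rewrite -lee_fin; apply: H.
apply: (@le_trans _ _ ((e / 2)%:E + (2 * M)%:E * (K * t)%:E)%E).
  rewrite leeD2l// lee_wpmul2l ?lee_fin ?mulr_ge0//.
  apply: le_trans (law_tail n_gt0 (L t0) (ltW t0) S dl0) _.
  by rewrite lee_fin /K -/rt (mulrC t) mulrA.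
rewrite -EFinM -EFinD lee_fin.
have : t * (2 * M * K + 1) <= e / 2.
  by rewrite -ler_pdivlMr//; near: t; apply: nbhs_right_le; rewrite !divr_gt0.
by nra.
Unshelve. all: by end_near. Qed.

(** A point of Euclidean norm [rt * m] is at least as far from 0 as the whole cube; its density is
    positive and serves as the bound. *)
Lemma heat_kernel_gt (t m : R) : 0 < t -> 0 < m ->
  exists2 c, 0 < c & forall z, `|z| <= m -> c <= p t z.
Proof.
move=> t0 m0; have [v vm] := @exists_enorm R n (rt * m) n_gt0 (ltW (mulr_gt0 rt_gt0 m0)).
exists (p t v); first exact: (density_gt0 n_gt0 S psi_gt0 _ t0 (L t0)).
move=> z zm; apply: unimodal_le (ul_density (L t0)) (ul_origin (L t0)) _.
by rewrite vm; apply: le_trans (enorm_le_norm z) _; rewrite ler_pM2l.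
Qed.

(** Far from [x1], [x2 - y] has at most twice the norm of [x1 - y], and [density_compare] applies at
    equal times. Near [x1], the left side is at most [p t 0] and [p t (x2 - y)] is bounded below. *)
Lemma heat_kernel_shift (t : R) (x1 x2 : 'rV[R]_n) : 0 < t ->
  exists C, forall y, p t (x1 - y) <= C * p t (x2 - y).
Proof.
move=> t0; have [r r0 tr] := exists_small_exponent n_gt0 S psi_gt0 t0.
have [K K0 HK] := density_compare n_gt0 S psi_gt0 t0 r0 tr (L t0).
pose D := `|x2 - x1|; have D0 : 0 <= D by exact: normr_ge0.
have rD0 : 0 < r + D + D by lra.
have [c c0 Hc] := heat_kernel_gt t0 rD0.
have p0 z : 0 <= p t z by case: (ul_density (L t0)).
exists (K + p t 0 / c) => y.
have tri : `|x2 - y| <= D + `|x1 - y|.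
  by rewrite -[x2 - y](subrKA x1); exact: ler_normD.
rewrite mulrDl; have [big|small] := leP (r + D) `|x1 - y|.
  apply: le_trans (HK t (mu t) (p t) t0 (lexx _) (L t0) _ (x2 - y) _ _) _.
  - by lra.
  - by lra.
  - by rewrite lerDl mulr_ge0// divr_ge0// ltW.
apply: (@le_trans _ _ (p t 0 / c * c)).
  by rewrite divfK ?gt_eqF//; exact: ul_origin (L t0) _.
apply: ler_wpDl; first by rewrite mulr_ge0// ltW.
by rewrite ler_wpM2l ?divr_ge0 ?(ltW c0)//; apply: Hc; lra.
Qed.

Lemma heat_kernel_ball_gt (x z : 'rV[R]_n) (t r : R) : 0 < t -> 0 < r ->
  exists2 C, 0 < C & forall y, eball z r y -> C <= p t (x - y).
Proof.
move=> t0 r0; have m0 : 0 < `|x - z| + r by rewrite ltr_wpDl.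
have [c c0 Hc] := heat_kernel_gt t0 m0; exists c => // y zy; apply: Hc.
rewrite -[x - y](subrKA z); apply: le_trans (ler_normD _ _) _.
by rewrite lerD2l distrC ltW//; exact: eball_sub_cube zy.
Qed.

(** A predicate of [g] and [K], so that both can later be chosen as functions of the horizon [T]. *)
Definition maximal_bound (T g K : R) : Prop :=
  forall (f : 'rV[R]_n -> \bar R) x t,
    measurable_fun setT f -> (forall y, (0 <= f y)%E) -> 0 < t -> t <= T ->
    (\int[lebesgue_rV R n]_y ((p t (x - y)%R)%:E * f y) <=
     ((8 * n%:R) ^+ n)%:E * local_maximal g f x +
     K%:E * \int[lebesgue_rV R n]_y ((p T (x - y)%R)%:E * f y))%E.

(** The cut is at a scale [r] with small exponent at time [T]: inside [cube x r] the maximal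
    function takes over, outside [density_compare] with [w = z] replaces [t] by [T]. *)
Lemma heat_kernel_maximal (T : R) : 0 < T ->
  exists gK : R * R, [/\ 0 < gK.1, 0 < gK.2 & maximal_bound T gK.1 gK.2].
Proof.
move=> T0; have [r r0 Tr] := exists_small_exponent n_gt0 S psi_gt0 T0.
have [K K0 HK] := density_compare n_gt0 S psi_gt0 T0 r0 Tr (L T0).
have rtr : 0 < rt * r by rewrite mulr_gt0.
(* The near part needs [rt * r] strictly below the radius of the maximal function. *)
exists (2 * (rt * r), K); split => //=; first by rewrite mulr_gt0.
move=> f x t mf f0 t0 tT.
have mC : measurable (cube x r) by exact: measurable_cube.
have mk s (s0 : 0 < s) := measurable_density_mul (x := x) mf (L s0).
have p0 s z : 0 < s -> 0 <= p s z by move=> s0; case: (ul_density (L s0)).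
have pf0 s y : 0 < s -> (0 <= (p s (x - y))%:E * f y)%E.
  by move=> s0; rewrite mule_ge0// lee_fin p0.
rewrite -{1}(setUv (cube x r)) ge0_integral_setU//; last 4 first.
- exact: measurableC.
- exact: mk.
- by move=> y _; exact: pf0.
- by rewrite disj_set2E setICr.
apply: leeD.
  apply: (integral_cube_le_maximal n_gt0 mf f0 (L t0) r0).
  by rewrite -/rt; lra.
rewrite -ge0_integralZl_EFin//; last 3 first.
- by move=> y _; exact: pf0.
- exact: mk.
- exact: ltW.
apply: (@le_trans _ _ (\int[lebesgue_rV R n]_(y in ~` cube x r)
    (K%:E * ((p T (x - y))%:E * f y)))%E).
  apply: ge0_le_integral => //.
  - exact: measurableC.
  - by move=> y _; exact: pf0.
  - exact: mk.
  - by apply: measurable_funeM; exact: mk.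
  - move=> y /negP; rewrite /cube/= -leNgt distrC => ry.
    rewrite muleA -EFinM lee_wpmul2r// lee_fin.
    apply: HK (L t0) _ _ ry _ => //; by have := normr_ge0 (x - y); lra.
apply: ge0_subset_integral => //.
- exact: measurableC.
- by apply: measurable_funeM; exact: mk.
- by move=> y _; rewrite mule_ge0 ?pf0// lee_fin ltW.
Qed.

End heat_kernel_properties.

(** * Assembly of the three heat kernel properties *)

Theorem lemma4p4 (R : realType) (n : nat) (d : measure_display)
    (Omega : measurableType d) (P : probability Omega R)
    (X : R -> {RV P >-> 'rV[R]_n})
    (p : R -> 'rV[R]_n -> R) (Psi : 'rV[R]_n -> R)
    (psi : R -> R) (al au cl cu : R)
    (n_gt0 : (0 < n)%N)
    (levyX : isotropic_unimodal_levy_process X p Psi)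
    (radial_Psi : forall xi, Psi xi = psi (enorm xi))
    (psi_ge0 : forall a : R, 0 <= a -> 0 <= psi a)
    (psi_continuous : {within `[0, +oo[, continuous psi})
    (psi_increasing : forall a b : R, 0 <= a -> a < b -> psi a < psi b)
    (al_gt0 : 0 < al) (al_le_au : al <= au) (au_lt2 : au < 2)
    (cl_gt0 : 0 < cl) (cl_le1 : cl <= 1) (cu_ge1 : 1 <= cu)
    (scaling : weak_scaling psi al au cl cu) :
  let phi := heat_kernel p in
  [/\ forall (f : 'rV[R]_n -> R) x, continuous f -> compactly_supported f ->
        (\int[lebesgue_rV R n]_y (phi t x y * f y)%:E)%E @[t --> 0^'+]
          --> (f x)%:E,
      (exists eta : R, [/\ 0 < eta, eta <= 1 &
        forall (r : R) x1 x2, 0 < r -> exists C : R, forall y,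
          phi (eta * r) x1 y <= C * phi r x2 y])
      /\
      (forall x (r : R) z, 0 < r -> exists2 C : R, 0 < C &
        forall y, eball z r y -> C <= phi r x y) &
      exists (gamma : R) (xi1 xi2 : 'rV[R]_n -> R -> R) (Gamma : R -> R),
      [/\ 1 <= gamma,
          forall x (t : R), 0 < t -> 1 < xi1 x t /\ 1 < xi2 x t,
          forall (t : R) A, 0 < t -> bounded_set A ->
            bounded_set [set xi1 x t | x in A] /\
            bounded_set [set xi2 x t | x in A],
          forall r : R, 0 < r -> 0 < Gamma r &
          forall (r : R) (f : 'rV[R]_n -> \bar R) (x : 'rV[R]_n), 0 < r ->
            measurable_fun [set: 'rV[R]_n] f -> (forall y, 0 <= f y)%E ->
            (ereal_sup [set \int[lebesgue_rV R n]_y ((phi t x y)%:E * f y)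
                       | t in `]0%R, r[]
             <= (xi1 x r)%:E * local_maximal (Gamma r) f x
                + (xi2 x r)%:E *
                  \int[lebesgue_rV R n]_y
                    ((phi (gamma * r)%R x y)%:E * f y))%E]].
Proof.
move=> phi.
have psi_gt0 a : 0 < a -> 0 < psi a.
  by move=> a0; apply: le_lt_trans (psi_ge0 0 (lexx _)) (psi_increasing _ _ _ a0).
have S := weak_scaling_dyadic psi_ge0 psi_increasing al_gt0 au_lt2 cl_gt0 cu_ge1
  scaling.
have L t (t0 : 0 < t) := process_unimodal_law levyX radial_Psi t0.
have n8 : 0 < (8 * n%:R) ^+ n :> R by rewrite exprn_gt0// mulr_gt0// ltr0n.
split.
- by move=> f x; exact: (heat_kernel_cvg n_gt0 S psi_gt0 L).
- split.
    exists 1; split => // r x1 x2 r0; rewrite mul1r.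
    exact: (heat_kernel_shift n_gt0 S psi_gt0 L).
  by move=> x r z r0; exact: (heat_kernel_ball_gt n_gt0 S psi_gt0 L).
have /choice[gK HgK] (T : R) : exists gK : R * R, 0 < T ->
    [/\ 0 < gK.1, 0 < gK.2 & maximal_bound (p := p) T gK.1 gK.2].
  (* At nonpositive times [(0, 0)] is a mere placeholder. *)
  have [T0|T0] := ltP 0 T; last by exists (0, 0).
  by have [gK H] := heat_kernel_maximal n_gt0 S psi_gt0 L T0; exists gK => _.
(* Adding 1 makes both factors exceed 1 strictly; neither depends on the space variable, whence
   their boundedness. *)
exists 1, (fun _ _ => 1 + (8 * n%:R) ^+ n), (fun _ T => 1 + (gK T).2),
  (fun T => (gK T).1).
have cst_bounded (A : set 'rV[R]_n) (c : R) : bounded_set [set c | _ in A].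
  by exists `|c|; split; [exact: num_real|move=> M cM _ [_ _ <-]; exact: ltW].
split => //.
- by move=> x t t0; have [_ K0 _] := HgK t t0; rewrite !ltrDl.
- by move=> r r0; have [] := HgK r r0.
move=> r f x r0 mf f0; have [g0 K0 H] := HgK r r0.
have M0 := local_maximal_ge0 (f := f) (x := x) g0.
have I0 : (0 <= \int[lebesgue_rV R n]_y ((phi (1 * r)%R x y)%:E * f y))%E.
  apply: integral_ge0 => y _; rewrite mule_ge0// lee_fin /phi /heat_kernel mul1r.
  by case: (ul_density (L r r0)).
apply: ge_ereal_sup => _ [t + <-]; rewrite /= in_itv/= => /andP[t0 tr].
apply: le_trans (H f x t mf f0 t0 (ltW tr)) _; apply: leeD.
  by rewrite lee_wpmul2r// lee_fin lerDr.
rewrite /phi /heat_kernel mul1r in I0 *.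
by rewrite lee_wpmul2r// lee_fin lerDr.
Qed.
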